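(* For every $\epsilon$ with $1/\epsilon\in[2,\log n]$, there is an algorithm in the binary-forking model without atomics (the $\sqrt{n}$-way FFT combined with the 2-way FFT with stages) that computes the DFT of an array of $n$ complex numbers with $O(n\log^{f(n,\epsilon)}n)$ work, $O(n)$ space, and $O(\log(1/\epsilon)\log n)$ span, where $$f(n,\epsilon)=\frac{1}{\log\log n}\left(\frac{\log n}{(1/\epsilon)\log(1/\epsilon)}+\log\big((1/\epsilon)\log(1/\epsilon)\big)\right).$$
   Context: The DFT of an array $a$ of $n$ complex numbers is the array $y$ with $y[i]=\sum_{j=0}^{n-1}a[j]\,w_n^{-ij}$, $i\in[0,n-1]$, where $w_n=e^{2\pi\sqrt{-1}/n}$. Binary-forking model: computation starts with a single thread; threads fork concurrent asynchronous child threads recursively and synchronize by joins; no locks or atomic instructions. Work is the total number of instructions, span the longest path in the computation DAG, space the memory allocated. Logarithms are base 2. *)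

(* Defs.v *)
(* MathComp / MathComp-Analysis. *)
From HB Require Import structures.
From mathcomp Require Import all_boot all_order all_algebra complex.
From mathcomp Require Import all_classical all_reals all_analysis.
Set Implicit Arguments.
Unset Strict Implicit.
Unset Printing Implicit Defensive.
Import Order.TTheory GRing.Theory Num.Theory.
Local Open Scope ring_scope.
Local Open Scope complex_scope.

(** * The discrete Fourier transform *)

(* w_m = e^(2 pi sqrt(-1) / m) *)
Definition root_unity (R : realType) (m : nat) : R[i] :=
  cos (2 * pi / m%:R) +i* sin (2 * pi / m%:R).

Definition dft (R : realType) (n : nat) (a : 'I_n -> R[i]) (i : 'I_n) : R[i] :=
  \sum_(j < n) a j * root_unity R n ^- (i * j)%N.

(** * The binary-forking model without atomics

   A program is a fixed finite list of procedures.  Each activation of a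
   procedure is a thread-local frame with registers for machine words (naturals)
   and registers for complex numbers; a program text mentions only finitely many
   of them, so a frame occupies O(1) space.  The threads share a memory whose
   cells hold complex numbers.  There is no test on complex numbers and no
   conversion from complex numbers to words.  The only trigonometric instruction
   loads w_m; other powers of roots of unity have to be computed.

   [Fork] starts two child threads and joins both; as with the spawn and sync of
   Cilk, each child hands the content of its registers number 0 back to its
   parent at the join, and all other communication is through the memory. *)

Inductive word_op := WAdd | WSub | WMul | WDiv | WMod.
Inductive complex_op := CAdd | CSub | CMul | CDiv.

(* Destination registers come first. *)
Inductive instr :=
| WordConst of nat & nat
| WordArith of word_op & nat & nat & nat
| RootUnity of nat & nat                    (* complex x := w_(word y) *)
| ComplexArith of complex_op & nat & nat & nat
| ReadCell of nat & nat                     (* complex x := memory[word y] *)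
| WriteCell of nat & nat.                   (* memory[word x] := complex y *)

(* The callee starts with its word registers 0, 1, 2, ... set to the caller's
   registers [word_args], its complex registers set to the caller's registers
   [complex_args], and all further registers 0.  Its word and complex registers
   number 0 are returned in [word_ret] and [complex_ret]. *)
Record invocation := Invocation {
  callee : nat;
  word_args : seq nat;
  complex_args : seq nat;
  word_ret : nat;
  complex_ret : nat }.

Inductive cmd :=
| Skip
| Instr of instr
| Seq of cmd & cmd
| IfLt of nat & nat & cmd & cmd             (* compares two word registers *)
| Call of invocation
| Fork of invocation & invocation.

Definition program := seq cmd.

Record frame (R : realType) := Frame {
  words : nat -> nat;
  complexes : nat -> R[i] }.

Definition memory (R : realType) := nat -> R[i].

Definition set_word (R : realType) (fr : frame R) (x v : nat) : frame R :=
  Frame [eta words fr with x |-> v] (complexes fr).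

Definition set_complex (R : realType) (fr : frame R) (x : nat) (v : R[i]) :
    frame R :=
  Frame (words fr) [eta complexes fr with x |-> v].

Definition word_eval (op : word_op) (u v : nat) : nat :=
  match op with
  | WAdd => u + v | WSub => u - v | WMul => u * v
  | WDiv => u %/ v | WMod => u %% v
  end%N.

Definition complex_eval (R : realType) (op : complex_op) (u v : R[i]) : R[i] :=
  match op with
  | CAdd => u + v | CSub => u - v | CMul => u * v | CDiv => u / v
  end.

Definition enter (R : realType) (fr : frame R) (v : invocation) : frame R :=
  Frame (nth 0%N [seq words fr x | x <- word_args v])
        (nth 0 [seq complexes fr x | x <- complex_args v]).

Definition return_to (R : realType) (fr : frame R) (v : invocation)
    (fr' : frame R) : frame R :=
  set_complex (set_word fr (word_ret v) (words fr' 0))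
              (complex_ret v) (complexes fr' 0).

(* What is recorded about a piece of computation: its number of instructions,
   the longest path in its DAG, the peak number of frames it has open at the
   same time when it is executed depth first by one processor, and the addresses
   that it reads and writes. *)
Record trace := Trace {
  trace_work : nat;
  trace_span : nat;
  trace_depth : nat;
  trace_reads : seq nat;
  trace_writes : seq nat }.

Definition unit_trace : trace := Trace 1 1 0 [::] [::].

Definition seq_trace (t1 t2 : trace) : trace :=
  Trace (trace_work t1 + trace_work t2)%N
        (trace_span t1 + trace_span t2)%N
        (maxn (trace_depth t1) (trace_depth t2))
        (trace_reads t1 ++ trace_reads t2)
        (trace_writes t1 ++ trace_writes t2).

Definition par_trace (t1 t2 : trace) : trace :=
  Trace (trace_work t1 + trace_work t2)%N
        (maxn (trace_span t1) (trace_span t2))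
        (maxn (trace_depth t1) (trace_depth t2))
        (trace_reads t1 ++ trace_reads t2)
        (trace_writes t1 ++ trace_writes t2).

Definition open_frame (t : trace) : trace :=
  Trace (trace_work t) (trace_span t) (trace_depth t).+1
        (trace_reads t) (trace_writes t).

(* No cell written by one thread is accessed by the other. *)
Definition race_free (t1 t2 : trace) : Prop :=
  forall a : nat,
    (a \in trace_writes t1 -> a \notin trace_reads t2 ++ trace_writes t2) /\
    (a \in trace_writes t2 -> a \notin trace_reads t1 ++ trace_writes t1).

(* [instr_exec W S i fr m fr' m' t]: an instruction whose result is a word
   must produce a word below [W], and memory addresses must be below [S];
   otherwise it has no execution. *)
Inductive instr_exec (R : realType) (W S : nat) :
    instr -> frame R -> memory R -> frame R -> memory R -> trace -> Prop :=
| exec_WordConst x k fr m :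
    (k < W)%N ->
    instr_exec W S (WordConst x k) fr m (set_word fr x k) m unit_trace
| exec_WordArith op x y z fr m :
    (word_eval op (words fr y) (words fr z) < W)%N ->
    instr_exec W S (WordArith op x y z) fr m
      (set_word fr x (word_eval op (words fr y) (words fr z))) m unit_trace
| exec_RootUnity x y fr m :
    instr_exec W S (RootUnity x y) fr m
      (set_complex fr x (root_unity R (words fr y))) m unit_trace
| exec_ComplexArith op x y z fr m :
    instr_exec W S (ComplexArith op x y z) fr m
      (set_complex fr x (complex_eval op (complexes fr y) (complexes fr z)))
      m unit_trace
| exec_ReadCell x y fr m :
    (words fr y < S)%N ->
    instr_exec W S (ReadCell x y) fr m (set_complex fr x (m (words fr y))) m
      (Trace 1 1 0 [:: words fr y] [::])
| exec_WriteCell x y fr m :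
    (words fr x < S)%N ->
    instr_exec W S (WriteCell x y) fr m
      fr [eta m with words fr x |-> complexes fr y]
      (Trace 1 1 0 [::] [:: words fr x]).

(* [exec P W S c fr m fr' m' t]: in program [P], with words below [W] and [S]
   memory cells, command [c] leads from frame [fr] and memory [m] to [fr'] and
   [m'], with trace [t].  A command that forks threads with a data race has no
   execution.  Hence the asynchronous children of a fork do not influence each
   other, every interleaving of their instructions has the effect of running
   one after the other, and the rule for [Fork] states that effect. *)
Inductive exec (R : realType) (P : program) (W S : nat) :
    cmd -> frame R -> memory R -> frame R -> memory R -> trace -> Prop :=
| exec_Skip fr m : exec P W S Skip fr m fr m unit_trace
| exec_Instr i fr m fr' m' t :
    instr_exec W S i fr m fr' m' t ->
    exec P W S (Instr i) fr m fr' m' t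
| exec_Seq c1 c2 fr m fr1 m1 t1 fr2 m2 t2 :
    exec P W S c1 fr m fr1 m1 t1 ->
    exec P W S c2 fr1 m1 fr2 m2 t2 ->
    exec P W S (Seq c1 c2) fr m fr2 m2 (seq_trace t1 t2)
| exec_IfLt x y c1 c2 fr m fr' m' t :
    exec P W S (if (words fr x < words fr y)%N then c1 else c2) fr m fr' m' t ->
    exec P W S (IfLt x y c1 c2) fr m fr' m' (seq_trace unit_trace t)
| exec_Call v fr m fr' m' t :
    exec P W S (nth Skip P (callee v)) (enter fr v) m fr' m' t ->
    exec P W S (Call v) fr m (return_to fr v fr') m'
      (seq_trace unit_trace (open_frame t))
| exec_Fork v1 v2 fr m fr1 m1 t1 fr2 m2 t2 :
    exec P W S (nth Skip P (callee v1)) (enter fr v1) m fr1 m1 t1 ->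
    exec P W S (nth Skip P (callee v2)) (enter fr v2) m1 fr2 m2 t2 ->
    race_free t1 t2 ->
    exec P W S (Fork v1 v2) fr m (return_to (return_to fr v1 fr1) v2 fr2) m2
      (* one instruction for the fork and one for the join *)
      (seq_trace unit_trace
         (seq_trace (par_trace (open_frame t1) (open_frame t2)) unit_trace)).

Lemma instr_exec_det (R : realType) (W S : nat) (i : instr) (fr : frame R)
    (m : memory R) fr1 m1 t1 fr2 m2 t2 :
  instr_exec W S i fr m fr1 m1 t1 -> instr_exec W S i fr m fr2 m2 t2 ->
  (fr1, m1, t1) = (fr2, m2, t2).
Proof. by case=> *; match goal with H : _ |- _ => by inversion H end. Qed.

(* Result, work, span and memory accesses do not depend on the execution. *)
Lemma exec_det (R : realType) (P : program) (W S : nat) (c : cmd)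
    (fr : frame R) (m : memory R) fr1 m1 t1 fr2 m2 t2 :
  exec P W S c fr m fr1 m1 t1 -> exec P W S c fr m fr2 m2 t2 ->
  (fr1, m1, t1) = (fr2, m2, t2).
Proof.
move=> H; elim: H fr2 m2 t2 => {c fr m fr1 m1 t1}.
- by move=> fr m fr2 m2 t2 H; inversion H.
- move=> i fr m fr1 m1 t1 Hi fr2 m2 t2 H; inversion H; subst.
  exact: instr_exec_det Hi _.
- move=> c1 c2 fr m fr1 m1 t1 fr1' m1' t1' _ IH1 _ IH2 fr2 m2 t2 H.
  inversion H; subst.
  have [? ? ?] := IH1 _ _ _ ltac:(eassumption); subst.
  by have [-> -> ->] := IH2 _ _ _ ltac:(eassumption).
- move=> x y c1 c2 fr m fr1 m1 t1 _ IH fr2 m2 t2 H; inversion H; subst.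
  by have [-> -> ->] := IH _ _ _ ltac:(eassumption).
- move=> v fr m fr1 m1 t1 _ IH fr2 m2 t2 H; inversion H; subst.
  by have [-> -> ->] := IH _ _ _ ltac:(eassumption).
- move=> v1 v2 fr m fr1 m1 t1 fr1' m1' t1' _ IH1 _ IH2 _ fr2 m2 t2 H.
  inversion H; subst.
  have [? ? ?] := IH1 _ _ _ ltac:(eassumption); subst.
  by have [-> -> ->] := IH2 _ _ _ ltac:(eassumption).
Qed.

(** * Algorithms for the DFT and their cost *)

Definition lg (R : realType) (x : R) : R := ln x / ln 2.

(* The single initial thread runs procedure 0 with the array length and the
   tuning parameter in its word registers 0 and 1. *)
Definition initial_frame (R : realType) (n q : nat) : frame R :=
  Frame (nth 0%N [:: n; q]) (fun _ => 0).

(* On every array [a] of length [n], stored in the cells 0 .. n-1 of a memory of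
   [S] cells that is otherwise uninitialised, program [P] terminates with the
   DFT of [a] in the cells n .. 2n-1, within the stated bounds.  Space is the
   [S] shared cells plus the frames (the initial one and the nested ones) that
   are open at the same time in a depth-first execution. *)
Definition computes_dft (R : realType) (P : program) (W n q : nat)
    (work_bound space_bound span_bound : R) : Prop :=
  exists S : nat,
    forall (a : 'I_n -> R[i]) (m : memory R),
      (forall i : 'I_n, m i = a i) ->
      exists (fr' : frame R) (m' : memory R) (t : trace),
        [/\ exec P W S (nth Skip P 0) (initial_frame R n q) m fr' m' t,
            forall i : 'I_n, m' (n + i)%N = dft a i,
            (trace_work t)%:R <= work_bound,
            (S + (trace_depth t).+1)%N%:R <= space_bound &
            (trace_span t)%:R <= span_bound].

Definition work_exponent (R : realType) (n : nat) (eps : R) : R :=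
  (lg (lg n%:R))^-1 *
  (lg n%:R / (eps^-1 * lg eps^-1) + lg (eps^-1 * lg eps^-1)).

(* Main.v *)
Require Import Defs.
From mathcomp Require Import all_boot all_order all_algebra complex.
From mathcomp Require Import all_classical all_reals all_analysis.
From mathcomp Require Import ring lra zify.
Set Implicit Arguments.
Unset Strict Implicit.
Unset Printing Implicit Defensive.
Import Order.TTheory GRing.Theory Num.Theory.
Local Open Scope ring_scope.

(* Since [i * j = 'C(i + j, 2) - 'C(i, 2) - 'C(j, 2)], a DFT of arbitrary length
   n is a correlation with the chirp [w_n ^ 'C(p, 2)] (Bluestein), hence three
   DFTs of length N = 2 ^ l with 2 n <= N <= 4 n.  Each of these makes k levels
   of the sqrt-way recursion, with 2 ^ k of the order of T = q lg q for
   q = 1 / eps, and evaluates the transforms of length about N ^ (1 / 2 ^ k)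
     that
   remain directly, every coefficient being a parallel tree sum; this plays the
   role of the 2-way FFT with stages.  A level has span O(l), and the 2 ^ k
   rounds of short transforms make the work O(N 2 ^ k 2 ^ (l / 2 ^ k)), which is
   O(n T 2 ^ (lg n / T)) = O(n (lg n) ^ f(n, eps)).  The span
   O(k l + 2 ^ k) is O(lg q lg n) because q <= lg n. *)

(** * Executions with resource bounds *)

(** Three difficulties shape the proof. The space must stay linear through all levels: a transform,
    whatever its depth, works on the cells of its own indices and on their twins at distance N, so
    parallel transforms never share scratch and nothing is allocated. The stack of frames must fit
    into O(n) too: its height is at most the span, hence O(lg q lg n), and lg n squared is at most 4
    n. Finally, twiddle factors must not cost a pass or a table per level: they are merged into the
    exponents, so one table of the powers of w_N serves everywhere. Table and chirps are computed by
    repeated squaring at O(l) per cell; this is affordable because l <= c 2 ^ k <= 2 ^ c 2 ^ k,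
    where 2 ^ c bounds the length of the short transforms. A level consists of two passes over all
    cells, one for the columns and one for the rows, so the cost per cell doubles from level to
    level; this is the origin of the factor 2 ^ k. *)

Section Execution.
Context (R : realType) (P : program) (W S : nat).
Implicit Types (c : cmd) (fr : frame R) (m : memory R) (t : trace).
Implicit Types (Q : frame R -> memory R -> Prop) (Rd Wr : nat -> Prop).

Lemma exec_unwritten c fr m fr' m' t :
  exec P W S c fr m fr' m' t ->
  forall a, a \notin trace_writes t -> m' a = m a.
Proof.
elim=> {c fr m fr' m' t} //=.
- move=> i fr m fr' m' t; case=> //= x y {}fr {}m _ a.
  by rewrite inE => /negbTE ->.
- move=> c1 c2 fr m fr1 m1 t1 fr2 m2 t2 _ IH1 _ IH2 a.
  by rewrite mem_cat negb_or => /andP[h1 h2]; rewrite IH2 // IH1.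
- move=> v1 v2 fr m fr1 m1 t1 fr2 m2 t2 _ IH1 _ IH2 _ a.
  by rewrite cats0 mem_cat negb_or => /andP[h1 h2]; rewrite IH2 // IH1.
Qed.

(** Each nested frame is opened by a call or a fork, which itself lies on the path that continues
    inside the frame. *)
Lemma exec_depth_le_span c fr m fr' m' t :
  exec P W S c fr m fr' m' t -> (trace_depth t <= trace_span t)%N.
Proof.
elim=> {c fr m fr' m' t} //=; try by move=> *; lia.
by move=> i fr m fr' m' t; case.
Qed.

(** The rule for [Fork] starts the second child in the memory left by the first, whereas loop
    iterations are specified from the memory at the fork. Moving an execution to a memory that
    agrees on the cells read bridges the two. *)
Lemma exec_local c fr m fr' m' t :
  exec P W S c fr m fr' m' t ->
  forall m1, (forall a, a \in trace_reads t -> m1 a = m a) ->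
  exec P W S c fr m1 fr'
    (fun a => if a \in trace_writes t then m' a else m1 a) t.
Proof.
elim=> {c fr m fr' m' t} /=.
- by move=> *; exact: exec_Skip.
- move=> i fr m fr' m' t H m1; apply: contraPP => /= + E; apply.
  apply: exec_Instr; case: H E => //=; try by move=> *; constructor.
  + move=> x y {}fr {}m lt E; rewrite -E ?inE //; exact: exec_ReadCell.
  + move=> x y {}fr {}m lt _.
    have -> : (fun a => if a \in [:: words fr x] then
        [eta m with words fr x |-> complexes fr y] a else m1 a) =
        [eta m1 with words fr x |-> complexes fr y].
      by apply/funext => a /=; rewrite inE; case: eqP.
    exact: exec_WriteCell.
- move=> c1 c2 fr m fr1 m1 t1 fr2 m2 t2 H1 IH1 H2 IH2 m' E.
  apply: exec_Seq; first by apply: IH1 => a h; apply: E; rewrite mem_cat h.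
  have -> : (fun a => if a \in trace_writes t1 ++ trace_writes t2 then m2 a
      else m' a) = (fun a => if a \in trace_writes t2 then m2 a else
      if a \in trace_writes t1 then m1 a else m' a).
    apply/funext => a; rewrite mem_cat.
    case: (boolP (a \in trace_writes t2)) => h2; first by rewrite orbT.
    by rewrite orbF; case: ifP => // _; rewrite (exec_unwritten H2 h2).
  apply: IH2 => a h; case: ifPn => // h1.
  by rewrite (exec_unwritten H1 h1) E // mem_cat h orbT.
- move=> x y c1 c2 fr m fr' m' t _ IH m1 E; apply: exec_IfLt; exact: IH.
- move=> v fr m fr' m' t _ IH m1 E; apply: exec_Call; exact: IH.
- move=> v1 v2 fr m fr1 m1 t1 fr2 m2 t2 H1 IH1 H2 IH2 rf m' E.
  rewrite !cats0 in E *.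
  apply: exec_Fork rf; first by apply: IH1 => a h; apply: E; rewrite mem_cat h.
  have -> : (fun a => if a \in trace_writes t1 ++ trace_writes t2 then m2 a
      else m' a) = (fun a => if a \in trace_writes t2 then m2 a else
      if a \in trace_writes t1 then m1 a else m' a).
    apply/funext => a; rewrite mem_cat.
    case: (boolP (a \in trace_writes t2)) => h2; first by rewrite orbT.
    by rewrite orbF; case: ifP => // _; rewrite (exec_unwritten H2 h2).
  apply: IH2 => a h; case: ifPn => // h1.
  by rewrite (exec_unwritten H1 h1) E // mem_cat h orbT.
Qed.

(* The number of open frames needs no bound of its own: it is at most the span. *)
Definition runs c fr m Rd Wr (w s : nat) Q : Prop :=
  exists fr' m' t,
    [/\ exec P W S c fr m fr' m' t,
        forall a, a \in trace_reads t -> Rd a,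
        forall a, a \in trace_writes t -> Wr a,
        (trace_work t <= w)%N /\ (trace_span t <= s)%N &
        Q fr' m'].

Lemma runs_weaken c fr m Rd Wr w s Q Rd' Wr' w' s' Q' :
  runs c fr m Rd Wr w s Q ->
  (forall a, Rd a -> Rd' a) -> (forall a, Wr a -> Wr' a) ->
  (w <= w')%N -> (s <= s')%N -> (forall fr' m', Q fr' m' -> Q' fr' m') ->
  runs c fr m Rd' Wr' w' s' Q'.
Proof.
move=> [fr' [m' [t [H hr hw [hw' hs] q]]]] sr sw lw ls sq.
exists fr', m', t; split; auto; lia.
Qed.

Lemma runs_unwritten c fr m Rd Wr w s Q :
  runs c fr m Rd Wr w s Q ->
  runs c fr m Rd Wr w s
    (fun fr' m' => Q fr' m' /\ forall a, ~ Wr a -> m' a = m a).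
Proof.
move=> [fr' [m' [t [H hr hw hc q]]]].
exists fr', m', t; split=> //; split=> // a na.
by apply: (exec_unwritten H); apply/negP => /hw.
Qed.

Lemma runs_skip fr m Rd Wr Q : Q fr m -> runs Skip fr m Rd Wr 1 1 Q.
Proof. by move=> q; exists fr, m, unit_trace; split=> //; exact: exec_Skip. Qed.

Lemma runs_seq c1 c2 fr m Rd Wr w1 s1 w2 s2 Q1 Q :
  runs c1 fr m Rd Wr w1 s1 Q1 ->
  (forall fr' m', Q1 fr' m' -> runs c2 fr' m' Rd Wr w2 s2 Q) ->
  runs (Seq c1 c2) fr m Rd Wr (w1 + w2)%N (s1 + s2)%N Q.
Proof.
move=> [fr1 [m1 [t1 [H1 hr1 hw1 [cw1 cs1] q1]]]] /(_ _ _ q1).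
move=> [fr2 [m2 [t2 [H2 hr2 hw2 [cw2 cs2] q2]]]].
exists fr2, m2, (seq_trace t1 t2); split => //=.
- exact: exec_Seq H1 H2.
- by move=> a; rewrite mem_cat => /orP[/hr1|/hr2].
- by move=> a; rewrite mem_cat => /orP[/hw1|/hw2].
- by rewrite !leq_add.
Qed.

Lemma runs_instr i fr' m' t c fr m Rd Wr w s Q :
  instr_exec W S i fr m fr' m' t -> trace_work t = 1%N -> trace_span t = 1%N ->
  (forall a, a \in trace_reads t -> Rd a) ->
  (forall a, a \in trace_writes t -> Wr a) ->
  runs c fr' m' Rd Wr w s Q ->
  runs (Seq (Instr i) c) fr m Rd Wr w.+1 s.+1 Q.
Proof.
move=> hi hw hs hr hwr H; rewrite -[w.+1]add1n -[s.+1]add1n.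
apply: (@runs_seq _ _ _ _ _ _ 1 1 w s
  (fun fr1 m1 => fr1 = fr' /\ m1 = m')); last by move=> _ _ [-> ->].
exists fr', m', t; split=> //; first exact: exec_Instr.
by rewrite hw hs.
Qed.

Lemma runs_const x k c fr m Rd Wr w s Q :
  (k < W)%N -> runs c (set_word fr x k) m Rd Wr w s Q ->
  runs (Seq (Instr (WordConst x k)) c) fr m Rd Wr w.+1 s.+1 Q.
Proof. by move=> lt; apply: runs_instr (exec_WordConst _ _ _ _ lt) _ _ _ _. Qed.

Lemma runs_arith op x y z c fr m Rd Wr w s Q :
  (word_eval op (words fr y) (words fr z) < W)%N ->
  runs c (set_word fr x (word_eval op (words fr y) (words fr z))) m
    Rd Wr w s Q ->
  runs (Seq (Instr (WordArith op x y z)) c) fr m Rd Wr w.+1 s.+1 Q.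
Proof. by move=> lt; apply: runs_instr (exec_WordArith _ _ _ lt) _ _ _ _. Qed.

Lemma runs_root x y c fr m Rd Wr w s Q :
  runs c (set_complex fr x (root_unity R (words fr y))) m Rd Wr w s Q ->
  runs (Seq (Instr (RootUnity x y)) c) fr m Rd Wr w.+1 s.+1 Q.
Proof. by apply: runs_instr (exec_RootUnity _ _ _ _ _ _) _ _ _ _. Qed.

Lemma runs_complex op x y z c fr m Rd Wr w s Q :
  runs c (set_complex fr x
      (complex_eval op (complexes fr y) (complexes fr z))) m Rd Wr w s Q ->
  runs (Seq (Instr (ComplexArith op x y z)) c) fr m Rd Wr w.+1 s.+1 Q.
Proof. by apply: runs_instr (exec_ComplexArith _ _ _ _ _ _ _ _) _ _ _ _. Qed.

Lemma runs_read x y c fr m Rd Wr w s Q :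
  (words fr y < S)%N -> Rd (words fr y) ->
  runs c (set_complex fr x (m (words fr y))) m Rd Wr w s Q ->
  runs (Seq (Instr (ReadCell x y)) c) fr m Rd Wr w.+1 s.+1 Q.
Proof.
move=> lt rd; apply: runs_instr (exec_ReadCell _ _ _ lt) _ _ _ _ => //.
by move=> a; rewrite inE => /eqP ->.
Qed.

Lemma runs_write x y c fr m Rd Wr w s Q :
  (words fr x < S)%N -> Wr (words fr x) ->
  runs c fr [eta m with words fr x |-> complexes fr y] Rd Wr w s Q ->
  runs (Seq (Instr (WriteCell x y)) c) fr m Rd Wr w.+1 s.+1 Q.
Proof.
move=> lt rd; apply: runs_instr (exec_WriteCell _ _ _ lt) _ _ _ _ => //.
by move=> a; rewrite inE => /eqP ->.
Qed.

Lemma runs_ifT x y c1 c2 fr m Rd Wr w s Q :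
  (words fr x < words fr y)%N -> runs c1 fr m Rd Wr w s Q ->
  runs (IfLt x y c1 c2) fr m Rd Wr w.+1 s.+1 Q.
Proof.
move=> lt [fr' [m' [t [H hr hw [cw cs] q]]]].
exists fr', m', (seq_trace unit_trace t); split=> //.
by apply: exec_IfLt; rewrite lt.
Qed.

Lemma runs_ifF x y c1 c2 fr m Rd Wr w s Q :
  (words fr y <= words fr x)%N -> runs c2 fr m Rd Wr w s Q ->
  runs (IfLt x y c1 c2) fr m Rd Wr w.+1 s.+1 Q.
Proof.
move=> le [fr' [m' [t [H hr hw [cw cs] q]]]].
exists fr', m', (seq_trace unit_trace t); split=> //.
by apply: exec_IfLt; rewrite ltnNge le.
Qed.

Lemma runs_if x y c1 c2 fr m Rd Wr w1 s1 w2 s2 Q :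
  ((words fr x < words fr y)%N -> runs c1 fr m Rd Wr w1 s1 Q) ->
  ((words fr y <= words fr x)%N -> runs c2 fr m Rd Wr w2 s2 Q) ->
  runs (IfLt x y c1 c2) fr m Rd Wr (maxn w1 w2).+1 (maxn s1 s2).+1 Q.
Proof.
move=> H1 H2; case: (ltnP (words fr x) (words fr y)) => h.
  by apply: runs_weaken (runs_ifT _ h (H1 h)) _ _ _ _ _ => //; lia.
by apply: runs_weaken (runs_ifF _ h (H2 h)) _ _ _ _ _ => //; lia.
Qed.

Lemma runs_call v fr m Rd Wr w s Q Q' :
  runs (nth Skip P (callee v)) (enter fr v) m Rd Wr w s Q ->
  (forall fr' m', Q fr' m' -> Q' (return_to fr v fr') m') ->
  runs (Call v) fr m Rd Wr w.+1 s.+1 Q'.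
Proof.
move=> [fr' [m' [t [H hr hw [cw cs] q]]]] sq.
exists (return_to fr v fr'), m', (seq_trace unit_trace (open_frame t)).
by split=> //=; [exact: exec_Call|exact: sq].
Qed.

(** Both children are specified from [m]. The memories [m1] and [m2] are those that each child would
    leave when run alone, so each describes the outcome only on the cells that its child may
    write. *)
Lemma runs_fork v1 v2 fr m Rd1 Wr1 w1 s1 Q1 Rd2 Wr2 w2 s2 Q2 s :
  runs (nth Skip P (callee v1)) (enter fr v1) m Rd1 Wr1 w1 s1 Q1 ->
  runs (nth Skip P (callee v2)) (enter fr v2) m Rd2 Wr2 w2 s2 Q2 ->
  (forall a, Wr1 a -> Rd2 a -> False) ->
  (forall a, Wr1 a -> Wr2 a -> False) ->
  (forall a, Rd1 a -> Wr2 a -> False) ->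
  (s1 <= s)%N -> (s2 <= s)%N ->
  runs (Fork v1 v2) fr m (fun a => Rd1 a \/ Rd2 a) (fun a => Wr1 a \/ Wr2 a)
    (w1 + w2 + 2)%N (s + 2)%N
    (fun fr' m' => exists fr1 m1 fr2 m2,
      [/\ fr' = return_to (return_to fr v1 fr1) v2 fr2, Q1 fr1 m1, Q2 fr2 m2,
          forall a, Wr1 a -> m' a = m1 a & forall a, Wr2 a -> m' a = m2 a]).
Proof.
move=> [fr1 [m1 [t1 [H1 hr1 hw1 [cw1 cs1] q1]]]].
move=> [fr2 [m2 [t2 [H2 hr2 hw2 [cw2 cs2] q2]]]] wr ww rw ls1 ls2.
have rf : race_free t1 t2.
  move=> a; split=> h; rewrite mem_cat; apply/negP => /orP[] h'.
  - exact: (wr a (hw1 _ h) (hr2 _ h')).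
  - exact: (ww a (hw1 _ h) (hw2 _ h')).
  - exact: (rw a (hr1 _ h') (hw2 _ h)).
  - exact: (ww a (hw1 _ h') (hw2 _ h)).
have H2' := @exec_local _ _ _ _ _ _ H2 m1.
have {}H2' : forall a, a \in trace_reads t2 -> m1 a = m a.
  move=> a h; apply: (exec_unwritten H1); apply/negP => /hw1 h1.
  exact: wr h1 (hr2 _ h).
have {}H2' := exec_local H2 H2'.
eexists _, _, _; split; first exact: exec_Fork H1 H2' rf.
- by move=> a /=; rewrite cats0 mem_cat => /orP[/hr1|/hr2]; [left|right].
- by move=> a /=; rewrite cats0 mem_cat => /orP[/hw1|/hw2]; [left|right].
- by rewrite /=; lia.
- exists fr1, m1, fr2, m2; split=> // a h.
    by case: ifPn => // /hw2 /(ww _ h).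
  case: ifPn => // h'; rewrite (exec_unwritten H2 h') (exec_unwritten H1) //.
  by apply/negP => /hw1 /ww; apply.
Qed.

Lemma runs_bound c fr m Rd Wr w s w' s' Q :
  runs c fr m Rd Wr w s Q -> (w <= w')%N -> (s <= s')%N ->
  runs c fr m Rd Wr w' s' Q.
Proof. by move=> H lw ls; apply: runs_weaken H _ _ lw ls _. Qed.

Lemma runs_last c fr m Rd Wr w s Q :
  runs c fr m Rd Wr w s Q ->
  runs (Seq c Skip) fr m Rd Wr (w + 1)%N (s + 1)%N Q.
Proof. by move=> H; apply: (runs_seq H) => fr' m' q; exact: runs_skip. Qed.

Lemma runs_call_seq v c fr m Rd1 Wr1 Rd Wr w1 s1 w2 s2 Q1 Q :
  runs (nth Skip P (callee v)) (enter fr v) m Rd1 Wr1 w1 s1 Q1 ->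
  (forall a, Rd1 a -> Rd a) -> (forall a, Wr1 a -> Wr a) ->
  (forall fr' m', Q1 fr' m' -> (forall a, ~ Wr1 a -> m' a = m a) ->
    runs c (return_to fr v fr') m' Rd Wr w2 s2 Q) ->
  runs (Seq (Call v) c) fr m Rd Wr (w1.+1 + w2)%N (s1.+1 + s2)%N Q.
Proof.
move=> /runs_unwritten H sr sw Hc.
pose Q2 fr2 m' := exists2 fr', fr2 = return_to fr v fr' &
  Q1 fr' m' /\ forall a, ~ Wr1 a -> m' a = m a.
apply: (@runs_seq _ _ _ _ _ _ _ _ _ _ Q2); last first.
  by move=> _ m' [fr' -> [q e]]; exact: Hc.
apply: runs_weaken (runs_call H _) sr sw (leqnn _) (leqnn _) _; last first.
  by move=> fr' m' H'; exact: H'.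
by move=> fr' m' H'; exists fr'.
Qed.

End Execution.

(** * Parallel loops as binary trees of forks *)

Definition block (cs : seq cmd) : cmd := foldr Seq Skip cs.

(* Arguments: [lo, cnt] and [E] words [env]; procedure [body] is run on [x :: env]
   for [lo <= x < lo + cnt].  Returns the sum of the complex results. *)
Definition par_for (self body E : nat) : cmd :=
  block [:: Instr (WordConst E.+2 2);
    IfLt 1 E.+2
      (Call (Invocation body (0 :: iota 2 E) [::] 0 0))
      (block [:: Instr (WordArith WDiv E.+3 1 E.+2);
        Instr (WordArith WSub E.+4 1 E.+3);
        Instr (WordArith WAdd E.+4.+1 0 E.+3);
        Fork (Invocation self [:: 0, E.+3 & iota 2 E] [::] 0 0)
          (Invocation self [:: E.+4.+1, E.+4 & iota 2 E] [::] 0 1);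
        Instr (ComplexArith CAdd 0 0 1)])]%N.

Definition call_frame (R : realType) (ws : seq nat) (cs : seq R[i]) : frame R :=
  Frame (nth 0%N ws) (nth 0 cs).

Section ParFor.
Context (R : realType) (P : program) (W S : nat).

(** An inner node of the tree adds 10 to the work of its halves and 10 to the span; the subtracted
    10 in the work bound is what remains when two halves are merged into one. [Q x] is determined by
    the cells in [Wr x], so it survives the other iterations. *)
Lemma runs_par_for_range (f g : nat) (env : seq nat) (m : memory R)
    (Rd Wr : nat -> nat -> Prop) (w s : nat) (val : nat -> R[i])
    (Q : nat -> memory R -> Prop) (l lo cnt : nat) :
  nth Skip P f = par_for f g (size env) -> (2 < W)%N -> (0 < cnt <= 2 ^ l)%N ->
  (lo + cnt <= W)%N ->
  (forall x m1 m2, (lo <= x < lo + cnt)%N ->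
    (forall a, Wr x a -> m1 a = m2 a) -> Q x m1 -> Q x m2) ->
  (forall x y a, (lo <= x < lo + cnt)%N -> (lo <= y < lo + cnt)%N -> x <> y ->
    Wr x a -> ~ (Rd y a \/ Wr y a)) ->
  (forall x, (lo <= x < lo + cnt)%N ->
    runs P W S (nth Skip P g) (call_frame (x :: env) [::]) m (Rd x) (Wr x) w s
      (fun fr' m' => complexes fr' 0 = val x /\ Q x m')) ->
  runs P W S (nth Skip P f) (call_frame [:: lo, cnt & env] [::]) m
    (fun a => exists2 x, (lo <= x < lo + cnt)%N & Rd x a)
    (fun a => exists2 x, (lo <= x < lo + cnt)%N & Wr x a)
    (cnt * (w + 15) - 10)%N (s + 10 * l.+1 - 4)%N
    (fun fr' m' => complexes fr' 0 = \sum_(lo <= x < lo + cnt) val x /\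
      forall x, (lo <= x < lo + cnt)%N -> Q x m').
Proof.
move=> Hf W2.
have envE (ws : nat -> nat) : (forall x, (x < size env)%N -> ws x.+2 = nth 0%N
  env x) ->
    [seq ws x | x <- iota 2 (size env)] = env.
  move=> H; apply: (@eq_from_nth _ 0%N); rewrite size_map size_iota //.
  move=> x lx; rewrite (nth_map 0%N) ?size_iota // nth_iota // add2n H //.
elim: l lo cnt => [|l IH] lo cnt hc hW loc dis H.
  have {hc} hc : cnt = 1%N by lia.
  subst cnt.
  have lo1 x : (lo <= x < lo + 1)%N -> x = lo by lia.
  have lolo : (lo <= lo < lo + 1)%N by lia.
  rewrite Hf; apply: (@runs_weaken _ _ _ _ _ _ _ (Rd lo) (Wr lo) ((w.+1.+1 +
    1).+1)%N ((s.+1.+1 + 1).+1)%N); first last.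
  - by move=> fr' m' H'; exact: H'.
  - lia.
  - lia.
  - by move=> a; exists lo.
  - by move=> a; exists lo.
  apply: runs_const => //.
  apply: runs_seq; last by move=> fr' m' H'; apply: runs_skip; exact: H'.
  apply: runs_ifT => /=; rewrite ?eqxx //=.
  apply: runs_call.
    rewrite /enter /= envE; first exact: H.
    by move=> x hx /=; rewrite !eqSS ltn_eqF.
  move=> fr' m' [h1 h2]; rewrite /= addn1 big_nat1; split=> [|x hx];
    first exact: h1.
  by rewrite (lo1 x) // addn1.
case: (leqP cnt (2 ^ l)) => hcl.
  have hcl' : (0 < cnt <= 2 ^ l)%N by lia.
  have := IH lo cnt hcl' hW loc dis H.
  by move=> /runs_weaken; apply=> //; lia.
have c1 : (1 < cnt)%N by apply: leq_ltn_trans hcl; rewrite expn_gt0.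
rewrite expnS mul2n in hc.
pose h := (cnt %/ 2)%N; pose r := (cnt - h)%N.
have hh : (0 < h <= 2 ^ l)%N by rewrite /h; lia.
have hr : (0 < r <= 2 ^ l)%N by rewrite /r /h; lia.
have hrE : (cnt = h + r)%N by rewrite /r /h; lia.
have inL x : (lo <= x < lo + h)%N -> (lo <= x < lo + cnt)%N by lia.
have inR x : (lo + h <= x < lo + h + r)%N -> (lo <= x < lo + cnt)%N by lia.
have L := IH lo h hh ltac:(lia) (fun x m1 m2 hx => loc x m1 m2 (inL x hx))
  (fun x y a hx hy => dis x y a (inL x hx) (inL y hy))
  (fun x hx => H x (inL x hx)).
have Rr := IH (lo + h)%N r hr ltac:(lia) (fun x m1 m2 hx => loc x m1 m2 (inR x
  hx))
  (fun x y a hx hy => dis x y a (inR x hx) (inR y hy))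
  (fun x hx => H x (inR x hx)).
rewrite Hf.
apply: (@runs_weaken _ _ _ _ _ _ _ _ _
  ((((h * (w + 15) - 10) + (r * (w + 15) - 10) + 2) + 2).+4 + 1).+1%N
  (((s + 10 * l.+1 - 4) + 2 + 2).+4 + 1).+1%N); first last.
- by move=> fr' m' H'; exact: H'.
- lia.
- nia.
- by move=> a; exact.
- by move=> a; exact.
apply: runs_const => //.
apply: runs_seq; last by move=> fr' m' H'; apply: runs_skip; exact: H'.
apply: runs_ifF => /=; rewrite ?eqxx //=.
apply: runs_arith => /=; rewrite !eqxx /=; first by lia.
apply: runs_arith => /=; rewrite ?eqxx /= ?(ltn_eqF (ltnSn _)) /=.
  lia.
apply: runs_arith => /=; rewrite ?eqxx /= -/h -/r ?(ltn_eqF (ltnSn _)) /=.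
  rewrite ?gtn_eqF //=; lia.
have n34 : ((size env).+3 == (size env).+4)%N = false by lia.
have n35 : ((size env).+3 == (size env).+4.+1)%N = false by lia.
have n45 : ((size env).+4 == (size env).+4.+1)%N = false by lia.
set fr := set_word _ _ _.
have E1 : enter fr (Invocation f [:: 0, (size env).+3 & iota 2 (size env)]%N
    [::] 0 0) = call_frame [:: lo, h & env] [::].
  rewrite /enter /= n35 n34 eqxx envE // => x hx /=.
  by rewrite !ifF //; lia.
have E2 : enter fr (Invocation f
    [:: (size env).+4.+1, (size env).+4 & iota 2 (size env)]%N
    [::] 0 1) = call_frame [:: (lo + h)%N, r & env] [::].
  rewrite /enter /= n45 !eqxx envE // => x hx /=.
  by rewrite !ifF //; lia.
apply: runs_seq.
  apply: runs_weaken; first apply: runs_fork.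
  - by rewrite /= E1; exact: L.
  - by rewrite /= E2; exact: Rr.
  - by move=> a [x hx wx] [y hy ry]; apply: (dis x y a _ _ _ wx); auto; lia.
  - by move=> a [x hx wx] [y hy ry]; apply: (dis x y a _ _ _ wx); auto; lia.
  - by move=> a [x hx rx] [y hy wy]; apply: (dis y x a _ _ _ wy); auto; lia.
  - exact: leqnn.
  - exact: leqnn.
  - by move=> a [] [x hx rx]; exists x => //; lia.
  - by move=> a [] [x hx rx]; exists x => //; lia.
  - exact: leqnn.
  - exact: leqnn.
  - by move=> fr' m' H'; exact: H'.
move=> _ m' [fr1 [m1 [fr2 [m2 [-> [s1 q1] [s2 q2] e1 e2]]]]].
apply: runs_complex => /=; apply: runs_skip => /=; split.
  by rewrite s1 s2 -big_cat_nat //; [rewrite -addnA -hrE|lia..].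
move=> x hx; case: (ltnP x (lo + h)) => hxl.
  apply: (loc x m1) (q1 x _); [by []| |lia].
  by move=> a wa; rewrite e1 //; exists x => //; lia.
apply: (loc x m2) (q2 x _); [by []| |lia].
by move=> a wa; rewrite e2 //; exists x => //; lia.
Qed.

Lemma runs_par_for (f g : nat) (env : seq nat) (m : memory R)
    (Rd Wr : nat -> nat -> Prop) (w s : nat) (val : nat -> R[i])
    (Q : nat -> memory R -> Prop) (l cnt : nat) :
  nth Skip P f = par_for f g (size env) -> (2 < W)%N -> (0 < cnt <= 2 ^ l)%N ->
  (cnt <= W)%N ->
  (forall x m1 m2, (x < cnt)%N ->
    (forall a, Wr x a -> m1 a = m2 a) -> Q x m1 -> Q x m2) ->
  (forall x y a, (x < cnt)%N -> (y < cnt)%N -> x <> y ->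
    Wr x a -> ~ (Rd y a \/ Wr y a)) ->
  (forall x, (x < cnt)%N ->
    runs P W S (nth Skip P g) (call_frame (x :: env) [::]) m (Rd x) (Wr x) w s
      (fun fr' m' => complexes fr' 0 = val x /\ Q x m')) ->
  runs P W S (nth Skip P f) (call_frame [:: 0%N, cnt & env] [::]) m
    (fun a => exists2 x, (x < cnt)%N & Rd x a)
    (fun a => exists2 x, (x < cnt)%N & Wr x a)
    (cnt * (w + 15))%N (s + 10 * l.+1)%N
    (fun fr' m' => complexes fr' 0 = \sum_(0 <= x < cnt) val x /\
      forall x, (x < cnt)%N -> Q x m').
Proof.
move=> Hf W2 hc hW loc dis H.
have := @runs_par_for_range f g env m Rd Wr w s val Q l 0 cnt Hf W2 hc hW loc
  dis H.
by move=> H'; apply: runs_weaken H' _ _ _ _ _ => //; lia.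
Qed.

End ParFor.

(** * The program *)

Local Notation load x k := (Instr (WordConst x k)) (only parsing).
Local Notation add x y z := (Instr (WordArith WAdd x y z)) (only parsing).
Local Notation sub x y z := (Instr (WordArith WSub x y z)) (only parsing).
Local Notation mul x y z := (Instr (WordArith WMul x y z)) (only parsing).
Local Notation div x y z := (Instr (WordArith WDiv x y z)) (only parsing).
Local Notation mod x y z := (Instr (WordArith WMod x y z)) (only parsing).
Local Notation root x y := (Instr (RootUnity x y)) (only parsing).
Local Notation cadd x y z := (Instr (ComplexArith CAdd x y z)) (only parsing).
Local Notation cmul x y z := (Instr (ComplexArith CMul x y z)) (only parsing).
Local Notation cdiv x y z := (Instr (ComplexArith CDiv x y z)) (only parsing).
Local Notation read x y := (Instr (ReadCell x y)) (only parsing).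
Local Notation write x y := (Instr (WriteCell x y)) (only parsing).
Local Notation call p ws cs r c := (Call (Invocation p ws cs r c)) (only
  parsing).

(* Arguments: [n, q].  Registers: 2 = l, 4 = N = 2 ^ l, 5 = k. *)
Definition main_proc : cmd := block [::
  call 1 [:: 0] [::] 2 0; load 3 2; add 2 2 3; call 2 [:: 2] [::] 4 0;
  call 1 [:: 1] [::] 5 0; mul 5 1 5; call 1 [:: 5] [::] 5 0; add 5 5 3;
  load 6 0; load 7 1; mul 8 3 4; mul 9 3 8;
  call 17 [:: 6; 4; 0; 4] [::] 10 0;
  call 4 [:: 2; 5; 8; 7; 6; 7; 4] [::] 10 0;
  call 4 [:: 2; 5; 9; 7; 6; 7; 4] [::] 10 0;
  call 19 [:: 6; 4; 4] [::] 10 0;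
  call 4 [:: 2; 5; 8; 7; 6; 7; 4] [::] 10 0;
  call 21 [:: 6; 0; 0; 4; 2] [::] 10 0]%N.

Definition log_proc : cmd := block [::
  load 1 2;
  IfLt 0 1 (block [:: load 0 0])
    (block [:: div 0 0 1; call 1 [:: 0] [::] 0 0; load 1 1; add 0 0 1])]%N.

Definition pow2_proc : cmd := block [::
  load 1 1;
  IfLt 0 1 (block [:: load 0 1])
    (block [:: sub 0 0 1; call 2 [:: 0] [::] 0 0; add 0 0 0])]%N.

(* Word argument [p], complex argument [z]; returns [z ^ p]. *)
Definition power_proc : cmd := block [::
  load 1 1;
  IfLt 0 1 (block [:: root 0 1])
    (block [:: load 2 2; mod 3 0 2; div 0 0 2; call 3 [:: 0] [:: 0] 4 1;
      cmul 1 1 1;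
      IfLt 3 1 (block [:: cadd 0 1 2]) (block [:: cmul 0 1 0])])]%N.

(* Arguments: [l, k, x, s, g, e, N].  Replaces the sequence [A j], [j < 2 ^ l],
   in the cells [x + s * j] by [i |-> \sum_j A j * w ^ (j * (g + e * i))], where
   [w ^ p] is in cell [N + p]; the cells [x + N + s * j] are scratch. *)
Definition fft_proc : cmd := block [::
  call 2 [:: 0] [::] 7 0; load 8 1; load 9 0;
  IfLt 1 8
    (block [:: call 13 [:: 9; 7; 2; 3; 4; 5; 6; 7] [::] 10 0])
    (block [:: load 10 2; div 11 0 10; sub 12 0 11; call 2 [:: 11] [::] 13 0;
      call 2 [:: 12] [::] 14 0; sub 15 1 8;
      call 5 [:: 9; 14; 11; 15; 2; 3; 4; 5; 6; 14] [::] 16 0;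
      call 7 [:: 9; 13; 12; 15; 2; 3; 4; 5; 6; 13; 14] [::] 16 0;
      call 9 [:: 9; 7; 2; 3; 6; 13; 14] [::] 16 0]);
  call 11 [:: 9; 7; 2; 3; 6] [::] 16 0]%N.

(* Arguments: [j2, l1, k, x, s, g, e, N, N2]. *)
Definition column_proc : cmd := block [::
  mul 9 4 0; add 9 3 9; mul 10 4 8; mul 11 5 8; mod 11 11 7; mul 12 6 8;
  call 4 [:: 1; 2; 9; 10; 11; 12; 7] [::] 13 1]%N.

(* Arguments: [i1, l2, k, x, s, g, e, N, N1, N2]. *)
Definition row_proc : cmd := block [::
  mul 10 9 0; mul 10 4 10; add 10 3 10; mul 11 6 0; add 11 5 11; mod 11 11 7;
  mul 12 6 8; call 4 [:: 1; 2; 10; 4; 11; 12; 7] [::] 13 1]%N.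

(* Arguments: [p, x, s, N, N1, N2]. *)
Definition transpose_proc : cmd := block [::
  mod 6 0 4; mul 6 5 6; div 7 0 4; add 6 6 7; mul 6 2 6; add 6 1 6; read 1 6;
  mul 7 2 0; add 7 1 7; add 7 7 3; write 7 1]%N.

(* Arguments: [i, x, s, N]. *)
Definition copy_proc : cmd := block [::
  mul 4 2 0; add 4 1 4; add 5 4 3; read 1 5; write 4 1]%N.

(* Arguments: [i, x, s, g, e, N, M]. *)
Definition leaf_proc : cmd := block [::
  load 7 0; mul 8 4 0; add 8 3 8; call 15 [:: 7; 6; 1; 2; 8; 5] [::] 9 1;
  mul 10 2 0; add 10 1 10; add 10 10 5; write 10 1]%N.

(* Arguments: [j, x, s, h, N]. *)
Definition term_proc : cmd := block [::
  mul 5 2 0; add 5 1 5; read 0 5; mul 6 0 3; mod 6 6 4; add 6 4 6; read 1 6;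
  cmul 0 0 1]%N.

(* Arguments: [p, n, N].  Complex registers: 2 = w_N ^ p, 3 = w_n,
   4 = w_n ^ (p * (p - 1) / 2). *)
Definition init_proc : cmd := block [::
  root 1 2; call 3 [:: 0] [:: 1] 9 2; add 3 2 0; write 3 2;
  load 4 1; sub 5 0 4; mul 5 0 5; load 4 2; div 5 5 4;
  root 3 1; call 3 [:: 5] [:: 3] 9 4; load 4 1; root 5 4; cdiv 5 5 4;
  add 6 2 2; add 7 6 0; add 8 6 6; add 8 8 0; write 8 5;
  IfLt 0 1 (block [:: read 6 0; cmul 6 6 4; write 7 6])
    (block [:: write 7 7])]%N.

(* Arguments: [p, N]. *)
Definition product_proc : cmd := block [::
  add 2 1 1; add 3 2 2; add 2 2 0; sub 4 1 0; mod 4 4 1; add 3 3 4;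
  read 1 2; read 2 3; cmul 1 1 2; write 2 1]%N.

(* Arguments: [i, n, N, l]. *)
Definition output_proc : cmd := block [::
  load 4 1; sub 5 0 4; mul 5 0 5; load 6 2; div 5 5 6; root 1 1;
  call 3 [:: 5] [:: 1] 9 2; root 3 4; cadd 3 3 3; call 3 [:: 3] [:: 3] 9 4;
  add 7 2 2; add 7 7 0; read 5 7; cmul 5 5 2; cdiv 5 5 4; add 8 1 0;
  write 8 5]%N.

Definition fft_program : program := [::
  main_proc; log_proc; pow2_proc; power_proc; fft_proc;
  par_for 5 6 8; column_proc; par_for 7 8 9; row_proc;
  par_for 9 10 5; transpose_proc; par_for 11 12 3; copy_proc;
  par_for 13 14 6; leaf_proc; par_for 15 16 4; term_proc;
  par_for 17 18 2; init_proc; par_for 19 20 1; product_proc;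
  par_for 21 22 3; output_proc].

(** * Powers of roots of unity and the scalar procedures *)

Lemma root_unity_exp (R : realType) (m k : nat) :
  root_unity R m ^+ k =
  Complex (cos (k%:R * (2 * pi / m%:R))) (sin (k%:R * (2 * pi / m%:R))).
Proof.
elim: k => [|k IH]; first by rewrite expr0 mul0r cos0 sin0.
rewrite exprSr IH /root_unity; set x := 2 * pi / m%:R.
rewrite -natr1 mulrDl mul1r cosD sinD.
by simpc; rewrite [X in Complex _ X]addrC.
Qed.

Lemma root_unity_exp_eq1 (R : realType) (m : nat) :
  (0 < m)%N -> root_unity R m ^+ m = 1.
Proof.
move=> m0; rewrite root_unity_exp mulrCA mulfV ?pnatr_eq0 -?lt0n // mulr1.
by rewrite mulr_natl cos2pi sin2pi.
Qed.

(** There is no instruction for complex constants: loading w_1 is how the programs obtain the number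
    1. *)
Lemma root_unity1 (R : realType) : root_unity R 1 = 1.
Proof. exact: (@root_unity_exp_eq1 R 1). Qed.

Section Procedures.
Context (R : realType) (W S : nat).
Hypothesis W2 : (2 < W)%N.
Local Notation runs := (runs fft_program W S).
Local Notation proc := (nth Skip fft_program).

Lemma runs_pow2 (l : nat) (m : memory R) Rd Wr :
  (2 ^ l < W)%N ->
  runs (proc 2) (call_frame [:: l] [::]) m Rd Wr (10 * l.+1) (10 * l.+1)
    (fun fr' m' => words fr' 0 = (2 ^ l)%N /\ m' = m).
Proof.
elim: l => [|l IH] lt; eapply runs_bound.
- apply: runs_const; first by lia.
  apply: runs_seq; last by move=> fr' m' H'; apply: runs_skip; exact: H'.
  apply: runs_ifT => //=; apply: runs_const; first by lia.
  by apply: runs_skip => /=.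
- by [].
- by [].
- apply: runs_const; first by lia.
  apply: runs_seq; last by move=> fr' m' H'; apply: runs_skip; exact: H'.
  apply: runs_ifF => //=; apply: runs_arith => /=; first
    by move: (ltn_expl l.+1 (isT : (1 < 2)%N)); lia.
  rewrite subn1 /=.
  apply: runs_call_seq; rewrite /enter /=.
  + by apply: IH; rewrite expnS in lt; lia.
  + by move=> a H; exact: H.
  + by move=> a H; exact: H.
  move=> fr' m' [e1 e2] _; apply: runs_arith => /=; first by rewrite e1;
    rewrite expnS in lt; lia.
  by apply: runs_skip => /=; rewrite e1 expnS mul2n addnn.
- lia.
- lia.
Qed.

Lemma runs_log (x : nat) (m : memory R) Rd Wr :
  (x < W)%N ->
  runs (proc 1) (call_frame [:: x] [::]) m Rd Wr
    (10 * (trunc_log 2 x).+1) (10 * (trunc_log 2 x).+1)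
    (fun fr' m' => words fr' 0 = trunc_log 2 x /\ m' = m).
Proof.
elim/ltn_ind: x => x IH lt; case: (ltnP x 2) => hx; eapply runs_bound.
- apply: runs_const; first by [].
  apply: runs_last; apply: runs_ifT => //=.
  apply: runs_const; [lia|apply: runs_skip => /=; split=> //].
  by apply/esym/eqP; rewrite trunc_log_eq0; lia.
- lia.
- lia.
- apply: runs_const; first by [].
  apply: runs_last; apply: runs_ifF => //=.
  apply: runs_arith => /=; first by lia.
  apply: runs_call_seq; rewrite /enter /=.
  + by apply: IH; lia.
  + by move=> a H; exact: H.
  + by move=> a H; exact: H.
  move=> fr' m' [e1 e2] _; apply: runs_const; first by lia.
  apply: runs_arith => /=.
    rewrite e1 addn1 divn2 -trunc_log2S //; apply: leq_ltn_trans lt.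
    have := @trunc_logP 2 x isT ltac:(lia).
    by have := ltn_expl (trunc_log 2 x) (isT : (1 < 2)%N); lia.
  by apply: runs_skip; rewrite /= e1 addn1 divn2 -trunc_log2S.
- by rewrite (trunc_log2S hx) divn2; lia.
- by rewrite (trunc_log2S hx) divn2; lia.
Qed.

Lemma runs_power (l p : nat) (z : R[i]) (m : memory R) Rd Wr :
  (p < 2 ^ l)%N -> (p < W)%N ->
  runs (proc 3) (call_frame [:: p] [:: z]) m Rd Wr (15 * l.+1) (15 * l.+1)
    (fun fr' m' => complexes fr' 0 = z ^+ p /\ m' = m).
Proof.
elim: l p => [|l IH] p lt lW; eapply runs_bound.
- apply: runs_const; first by lia.
  apply: runs_last; apply: runs_ifT => /=; first by lia.
  apply: runs_root; apply: runs_skip => /=.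
  by rewrite root_unity1; have -> : p = 0%N by lia.
- by [].
- by [].
- apply: runs_const; first by lia.
  apply: runs_last; apply: runs_if => /= hx.
    apply: runs_root; apply: runs_skip => /=.
    by rewrite root_unity1; have -> : p = 0%N by lia.
  apply: runs_const; first by lia.
  apply: runs_arith => /=; first by lia.
  apply: runs_arith => /=; first by lia.
  apply: runs_call_seq; rewrite /enter /=.
  + by apply: IH; [rewrite expnS in lt; lia|lia].
  + by move=> a H; exact: H.
  + by move=> a H; exact: H.
  move=> fr' m' [e1 e2] _; apply: runs_complex => /=.
  rewrite e1 -exprD; apply: runs_last; apply: runs_if => /= hp.
    (* For even [p] the square is copied to register 0 by adding register 2, which still holds its
       initial value 0. *)
    apply: runs_complex; apply: runs_skip => /=.
    by rewrite addr0; have -> // : (p %/ 2 + p %/ 2 = p)%N by lia.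
  apply: runs_complex; apply: runs_skip => /=.
  by rewrite -exprSr; have -> // : ((p %/ 2 + p %/ 2).+1 = p)%N by lia.
- lia.
- lia.
Qed.

End Procedures.

(** * Transforms of length a power of two *)

Lemma big_nat_divmod (V : nmodType) (a b : nat) (f : nat -> V) :
  \sum_(0 <= j < a * b) f j =
  \sum_(0 <= j1 < a) \sum_(0 <= j2 < b) f (j1 * b + j2)%N.
Proof.
elim: a => [|a IH]; first by rewrite mul0n !big_geq.
rewrite mulSn addnC big_nat_recr //= -IH (@big_cat_nat _ _ _ (a * b)) ?leq_addr
  //=.
by congr (_ + _); rewrite -{1}[(a * b)%N]add0n big_addn addKn;
  apply: eq_bigr => i _; rewrite addnC.
Qed.

(* The Cooley-Tukey step for sums twisted by [w ^ (j * g)]: the inner transforms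
   absorb the twiddle factors into their own twist [g + e * i1]. *)
Lemma cooley_tukey (K : comNzRingType) (w : K) (N N1 N2 e g i1 i2 : nat)
    (A : nat -> K) :
  w ^+ N = 1 -> (N1 * N2 * e)%N = N ->
  \sum_(0 <= j2 < N2)
    (\sum_(0 <= j1 < N1)
       A (j2 + N2 * j1)%N * w ^+ (j1 * ((g * N2) %% N + e * N2 * i1))) *
    w ^+ (j2 * ((g + e * i1) %% N + e * N1 * i2)) =
  \sum_(0 <= j < N1 * N2) A j * w ^+ (j * (g + e * (i1 + N1 * i2))).
Proof.
move=> wN NE; rewrite big_nat_divmod exchange_big; apply: eq_bigr => j2 _ /=.
rewrite big_distrl /=; apply: eq_bigr => j1 _.
rewrite [(j2 + _)%N]addnC [(N2 * j1)%N]mulnC -mulrA; congr (_ * _).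
have modE a b c : w ^+ (a * (b %% N + c)) = w ^+ (a * (b + c)).
  by rewrite !mulnDr !exprD; congr (_ * _);
    rewrite mulnC exprM (expr_mod _ wN) -exprM mulnC.
rewrite !modE -exprD.
(* The exponents on the two sides differ by N * (j1 * i2), the cross term of the two-dimensional
   index. *)
rewrite -[LHS]mulr1 -[1](expr1n _ (j1 * i2)) -{}wN -exprM -exprD -NE.
by congr (_ ^+ _); ring.
Qed.

(** The scratch cell of an index lies at distance N from its data cell at every level of the
    recursion. A transform of a subset of the indices thus owns both cells of these indices, and
    disjoint subsets never collide. *)
Definition fft_cells (N x s M a : nat) : Prop :=
  exists2 j, (j < M)%N & a = (x + s * j)%N \/ a = (x + N + s * j)%N.

Lemma fft_cells_inj (N x s M a j1 j2 : nat) :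
  (0 < s)%N -> (s * M <= N)%N -> (j1 < M)%N -> (j2 < M)%N ->
  a = (x + s * j1)%N \/ a = (x + N + s * j1)%N ->
  a = (x + s * j2)%N \/ a = (x + N + s * j2)%N -> j1 = j2.
Proof.
move=> s0 sM l1 l2.
have b j : (j < M)%N -> (s * j < N)%N.
  by move=> lj; apply: leq_trans sM; rewrite ltn_pmul2l.
have := b _ l1; have := b _ l2 => b2 b1 h1 h2.
have : (s * j1 = s * j2)%N by lia.
by move/eqP; rewrite eqn_pmul2l // => /eqP.
Qed.

Section Transform.
Context (R : realType) (W S N : nat) (w : R[i]).
Hypothesis W2 : (2 < W)%N.
Hypothesis SW : (S <= W)%N.
Hypothesis NW : (2 * N * N < W)%N.
Hypothesis N0 : (0 < N)%N.
Hypothesis NS : (2 * N <= S)%N.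
Hypothesis wN : w ^+ N = 1.
Local Notation runs := (runs fft_program W S).
Local Notation proc := (nth Skip fft_program).

Definition in_table (a : nat) : Prop := (N <= a < 2 * N)%N.

Definition table (m : memory R) : Prop :=
  forall p, (p < N)%N -> m (N + p)%N = w ^+ p.

Lemma runs_term (m : memory R) (x s h j : nat) Wr :
  table m -> (x + s * j < S)%N -> (j < N)%N -> (h < 2 * N)%N ->
  runs (proc 16) (call_frame [:: j; x; s; h; N] [::]) m
    (fun a => a = x + s * j \/ in_table a)%N Wr 9 9
    (fun fr' m' => complexes fr' 0 = m (x + s * j)%N * w ^+ (j * h) /\ True).
Proof.
move=> tab xj jN hN.
have pN : ((j * h) %% N < N)%N by rewrite ltn_mod.
apply: runs_arith => /=; first by lia.
apply: runs_arith => /=; first by lia.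
apply: runs_read => /=; [by lia|by left|].
apply: runs_arith => /=; first by nia.
apply: runs_arith => /=; first by lia.
apply: runs_arith => /=; first by lia.
apply: runs_read => /=; [by lia|by right; rewrite /in_table; lia|].
apply: runs_complex => /=; apply: runs_skip => /=.
by rewrite tab // (expr_mod _ wN).
Qed.

Lemma runs_leaf (m : memory R) (l x s g e i : nat) :
  table m -> (2 ^ l * e = N)%N -> (g < N)%N -> (i < 2 ^ l)%N ->
  (forall j, (j < 2 ^ l)%N -> (x + N + s * j < S)%N) ->
  runs (proc 14) (call_frame [:: i; x; s; g; e; N; 2 ^ l] [::])%N m
    (fun a => (exists2 j, (j < 2 ^ l)%N & a = x + s * j)%N \/ in_table a)
    (fun a => a = x + N + s * i)%N
    (2 ^ l * 24 + 20)%N (10 * l + 40)%N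
    (fun fr' m' => complexes fr' 0 = 0 /\ m' (x + N + s * i)%N =
      \sum_(0 <= j < 2 ^ l) m (x + s * j)%N * w ^+ (j * (g + e * i))).
Proof.
move=> tab MN gN iM xS; have xi := xS i iM.
have e0 : (0 < e)%N by case: (e) MN N0 => //; rewrite muln0 => <-.
have eiN : (e * i < N)%N by rewrite -MN mulnC ltn_mul2r iM andbT.
have MN' : (2 ^ l <= N)%N by rewrite -MN leq_pmulr.
eapply runs_bound.
- apply: runs_const; first by lia.
  apply: runs_arith => /=; first by nia.
  apply: runs_arith => /=; first by nia.
  apply: runs_call_seq; rewrite /enter /=.
  + apply: (@runs_par_for _ _ _ _ 15 16 [:: x; s; (g + e * i)%N; N] _
      (fun j a => a = x + s * j \/ in_table a)%N (fun _ _ => False) _ _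
      _ (fun _ _ => True) l) => //=.
    * by rewrite expn_gt0 leqnn.
    * by nia.
    * move=> j jM; have := xS j jM => xj.
      by apply: runs_term => //; lia.
  + by move=> a [j jM [->|h]]; [left; exists j|right].
  + by move=> a [].
  move=> fr' m' [e1 _] e2; have {}e2 : m' = m by apply/funext => a;
    apply: e2 => -[].
  apply: runs_arith => /=; first by lia.
  apply: runs_arith => /=; first by lia.
  apply: runs_arith => /=; first by lia.
  have -> : (x + s * i + N = x + N + s * i)%N by lia.
  apply: runs_write => //=.
  by apply: runs_skip; rewrite /= eqxx e1.
- by lia.
- by lia.
Qed.

Lemma runs_copy (m : memory R) (x s i : nat) :
  (x + N + s * i < S)%N ->
  runs (proc 12) (call_frame [:: i; x; s; N] [::])%N m
    (fun a => a = x + N + s * i)%N (fun a => a = x + s * i)%N 6 6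
    (fun fr' m' => complexes fr' 0 = 0 /\
      m' (x + s * i)%N = m (x + N + s * i)%N).
Proof.
move=> xi; have E : (x + s * i + N = x + N + s * i)%N by lia.
apply: runs_arith => /=; first by lia.
apply: runs_arith => /=; first by lia.
apply: runs_arith => /=; first by lia.
apply: runs_read => //=; first by lia.
apply: runs_write => //=; first by lia.
by apply: runs_skip => /=; rewrite eqxx E.
Qed.

(** After the two passes the coefficient of index i1 + N1 * i2 sits at index N2 * i1 + i2. Here p is
    its proper index, with i1 = p mod N1 and i2 = p div N1. *)
Lemma runs_transpose (m : memory R) (x s p N1 N2 : nat) :
  (0 < s)%N -> (x + N + s * p < S)%N ->
  (forall j, (j < N1 * N2)%N -> (x + N + s * j < S)%N) ->
  (p < N1 * N2)%N ->
  runs (proc 10) (call_frame [:: p; x; s; N; N1; N2] [::])%N m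
    (fun a => a = x + s * (N2 * (p %% N1) + p %/ N1))%N
    (fun a => a = x + N + s * p)%N 12 12
    (fun fr' m' => complexes fr' 0 = 0 /\
      m' (x + N + s * p)%N = m (x + s * (N2 * (p %% N1) + p %/ N1))%N).
Proof.
move=> s0 xp xS pM.
have N1pos : (0 < N1)%N by case: (N1) pM.
have qN2 : (p %/ N1 < N2)%N by rewrite ltn_divLR // mulnC.
have pN1 : (p %% N1 < N1)%N by rewrite ltn_mod.
have qM : (N2 * (p %% N1) + p %/ N1 < N1 * N2)%N by nia.
have := xS _ qM; set q := (N2 * (p %% N1) + p %/ N1)%N => xq.
have qs : (q <= s * q)%N by exact: leq_pmull.
have ps : (p <= s * p)%N by exact: leq_pmull.
have pm : (p %% N1 <= p)%N by exact: leq_mod.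
have pd : (p %/ N1 <= p)%N by exact: leq_div.
have qE : (N2 * (p %% N1) <= q)%N by exact: leq_addr.
apply: runs_arith => /=; first by lia.
apply: runs_arith => /=; first by lia.
apply: runs_arith => /=; first by lia.
apply: runs_arith => /=; rewrite -/q; first by lia.
apply: runs_arith => /=; first by lia.
apply: runs_arith => /=; first by lia.
apply: runs_read => //=; first by lia.
apply: runs_arith => /=; first by lia.
apply: runs_arith => /=; first by lia.
apply: runs_arith => /=; first by lia.
have -> : (x + s * p + N = x + N + s * p)%N by lia.
apply: runs_write => //=.
by apply: runs_skip => /=; rewrite eqxx.
Qed.

(* Solves f (k + 1) = 2 f k + 400, the cost per cell of a level, from the cost
   120 * 2 ^ c of direct evaluation at length at most 2 ^ c. *)
Definition fft_work (c k : nat) : nat := (2 ^ k * (120 * 2 ^ c + 400) - 400)%N.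

Lemma fft_workS (c k : nat) : fft_work c k.+1 = (2 * fft_work c k + 400)%N.
Proof.
rewrite /fft_work expnS -mulnA.
have : (0 < 2 ^ k * (120 * 2 ^ c + 400))%N
  by rewrite muln_gt0 expn_gt0 addn_gt0 orbT.
have : (400 <= 2 ^ k * (120 * 2 ^ c + 400))%N.
  by apply: leq_trans (leq_pmull _ _); rewrite ?expn_gt0 // leq_addl.
lia.
Qed.

(** The columns precede the rows, so the span of a transform is a sum over a binary recursion tree
    with k + 1 levels. The logarithms of the lengths on each level add up to l, giving 100 l per
    level; the 2 ^ (k + 1) - 1 nodes contribute 400 each. *)
Definition fft_span (l k : nat) : nat :=
  (100 * l * k.+1 + 400 * (2 ^ k.+1 - 1))%N.

(** A statement about k alone, so that the induction on levels is free to change length, offset,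
    stride and twist. [c] serves the cost bound: halving l, even when rounded up, turns l <= c * 2 ^
    (k + 1) into the same bound for k, hence length at most 2 ^ c at the bottom. *)
Definition fft_correct (k : nat) : Prop :=
  forall (m : memory R) (l c x s g e : nat),
  table m -> (2 ^ l * e = N)%N -> (0 < s)%N -> (s * 2 ^ l <= N)%N ->
  (g < N)%N -> (2 * N <= x)%N -> (k < W)%N ->
  (forall j, (j < 2 ^ l)%N -> (x + N + s * j < S)%N) -> (l <= c * 2 ^ k)%N ->
  runs (proc 4) (call_frame [:: l; k; x; s; g; e; N] [::])%N m
    (fun a => fft_cells N x s (2 ^ l) a \/ in_table a)
    (fft_cells N x s (2 ^ l))
    (2 ^ l * fft_work c k)%N (fft_span l k)
    (fun fr' m' => forall i, (i < 2 ^ l)%N -> m' (x + s * i)%N =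
      \sum_(0 <= j < 2 ^ l) m (x + s * j)%N * w ^+ (j * (g + e * i))).

(* The last step of [fft_proc]: the result is still in the scratch cells. *)
Lemma runs_fft_copy (fr : frame R) (m : memory R) (l x s : nat)
    (y : nat -> R[i]) Rd :
  (0 < s)%N -> (s * 2 ^ l <= N)%N ->
  (forall j, (j < 2 ^ l)%N -> (x + N + s * j < S)%N) ->
  enter fr (Invocation 11 [:: 9; 7; 2; 3; 6] [::] 16 0)%N =
    call_frame [:: 0; 2 ^ l; x; s; N]%N [::] ->
  (forall i, (i < 2 ^ l)%N -> m (x + N + s * i)%N = y i) ->
  (forall a, fft_cells N x s (2 ^ l) a -> Rd a) ->
  runs (block [:: call 11 [:: 9; 7; 2; 3; 6] [::] 16 0]%N) fr m
    Rd (fft_cells N x s (2 ^ l)) (2 ^ l * 21 + 2)%N (10 * l + 18)%N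
    (fun fr' m' => forall i, (i < 2 ^ l)%N -> m' (x + s * i)%N = y i).
Proof.
move=> s0 sM xS frE my sub.
have MN : (2 ^ l <= N)%N by apply: leq_trans sM; exact: leq_pmull.
have sj j : (j < 2 ^ l)%N -> (s * j < N)%N.
  by move=> lj; apply: leq_trans sM; rewrite ltn_pmul2l.
eapply runs_bound.
- apply: runs_call_seq; rewrite ?frE.
  + apply: (@runs_par_for _ _ _ _ 11 12 [:: x; s; N] _
      (fun i a => a = x + N + s * i)%N (fun i a => a = x + s * i)%N _ _
      _ (fun i m' => m' (x + s * i)%N = m (x + N + s * i)%N) l) => //=.
    * by rewrite expn_gt0 leqnn.
    * by nia.
    * by move=> i ma mb lti H; rewrite -H.
    * move=> i j a lti ltj ne -> [h|/eqP].
        by have := sj _ ltj; have := sj _ lti; lia.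
      by rewrite eqn_add2l eqn_pmul2l // => /eqP.
    * by move=> i lti; apply: runs_copy; exact: xS.
  + by move=> a [i lti ->]; apply: sub; exists i => //; right.
  + by move=> a [i lti ->]; exists i => //; left.
  move=> fr2 m2 [_ q2] u2; apply: runs_skip => i lti.
  by rewrite q2 // my.
- lia.
- lia.
Qed.

Lemma runs_fft0 : fft_correct 0.
Proof.
move=> m l c x s g e tab MN s0 sM gN xN _ xS lc.
have e0 : (0 < e)%N by case: (e) MN N0 => //; rewrite muln0 => <-.
have MN' : (2 ^ l <= N)%N by rewrite -MN leq_pmulr.
have lM : (l < 2 ^ l)%N by exact: ltn_expl.
have MW : (2 ^ l < W)%N by nia.
have sj j : (j < 2 ^ l)%N -> (s * j < N)%N.
  by move=> lj; apply: leq_trans sM; rewrite ltn_pmul2l.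
eapply runs_bound.
- apply: runs_call_seq; rewrite /enter /=.
  + by apply: runs_pow2.
  + by move=> a H; exact: H.
  + by move=> a H; exact: H.
  move=> fr1 m1 [e1 ->] _.
  apply: runs_const; first by lia.
  apply: runs_const; first by lia.
  (* What holds where the two branches of the conditional meet: the result is in scratch, and the
     registers that are passed to the final copy are intact. *)
  apply: (@runs_seq _ _ _ _ _ _ _ _ _ _ _ _ _ _ (fun fr2 m2 =>
      enter fr2 (Invocation 11 [:: 9; 7; 2; 3; 6] [::] 16 0)%N =
        call_frame [:: 0; 2 ^ l; x; s; N]%N [::] /\
      forall i, (i < 2 ^ l)%N -> m2 (x + N + s * i)%N =
         \sum_(0 <= j < 2 ^ l) m (x + s * j)%N * w ^+ (j * (g + e * i)))).
    apply: runs_ifT => //=; apply: runs_call_seq; rewrite /enter /= ?e1.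
    + apply: (@runs_par_for _ _ _ _ 13 14 [:: x; s; g; e; N; (2 ^ l)%N] _
      (fun i a => (exists2 j, (j < 2 ^ l)%N & a = x + s * j) \/ in_table a)%N
      (fun i a => a = x + N + s * i)%N _ _
      _ (fun i m' => m' (x + N + s * i)%N =
         \sum_(0 <= j < 2 ^ l) m (x + s * j)%N * w ^+ (j * (g + e * i))) l) =>
           //=.
      * by rewrite expn_gt0 leqnn.
      * exact: ltnW.
      * by move=> i ma mb lti H; rewrite -H.
      * move=> i j a lti ltj ne -> [[[h lth]|]|].
        -- by have := sj _ lth; have := sj _ lti; lia.
        -- by rewrite /in_table; lia.
        -- by move/eqP; rewrite eqn_add2l eqn_pmul2l // => /eqP.
      * by move=> i lti; exact: (@runs_leaf m l x s g e i).
    + move=> a [i lti [[j ltj ->]|h]]; last by right.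
      by left; exists j => //; left.
    + by move=> a [i lti ->]; exists i => //; right.
    move=> fr2 m2 [_ q2] u2; apply: runs_skip; split=> //.
    by rewrite /enter /= e1.
  move=> fr2 m2 [frE q2]; apply: runs_fft_copy frE q2 _ => //.
  by move=> a h; left.
- have : (2 ^ l <= 2 ^ c)%N by rewrite leq_exp2l //; rewrite expn0 muln1 in lc.
  by rewrite /fft_work expn0; nia.
- by rewrite /fft_span expn1; lia.
Qed.

(** Fixing the residue i of the index modulo 2 ^ l2 multiplies stride, twist and root exponent by 2
    ^ l2. The twist is reduced modulo N to keep the words small at every depth. *)
Lemma runs_column (k : nat) (m : memory R) (l1 l2 c x s g e i : nat) :
  fft_correct k ->
  table m -> (2 ^ l1 * 2 ^ l2 * e = N)%N -> (0 < s)%N ->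
  (s * (2 ^ l1 * 2 ^ l2) <= N)%N -> (g < N)%N -> (2 * N <= x)%N -> (k < W)%N ->
  (forall j, (j < 2 ^ l1 * 2 ^ l2)%N -> (x + N + s * j < S)%N) ->
  (l1 <= c * 2 ^ k)%N -> (i < 2 ^ l2)%N ->
  runs (proc 6) (call_frame [:: i; l1; k; x; s; g; e; N; 2 ^ l2] [::])%N m
    (fun a => fft_cells N (x + s * i) (s * 2 ^ l2) (2 ^ l1) a \/ in_table a)
    (fft_cells N (x + s * i) (s * 2 ^ l2) (2 ^ l1))
    (2 ^ l1 * fft_work c k + 8)%N (fft_span l1 k + 8)%N
    (fun fr' m' => complexes fr' 0 = 0 /\
      forall i1, (i1 < 2 ^ l1)%N -> m' (x + s * i + s * 2 ^ l2 * i1)%N =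
      \sum_(0 <= j < 2 ^ l1) m (x + s * i + s * 2 ^ l2 * j)%N *
        w ^+ (j * ((g * 2 ^ l2) %% N + e * 2 ^ l2 * i1))).
Proof.
move=> IH tab MN s0 sM gN xN kW xS lc lti.
have e0 : (0 < e)%N by case: (e) MN N0 => //; rewrite muln0 => <-.
have p1 : (0 < 2 ^ l1)%N by rewrite expn_gt0.
have p2 : (0 < 2 ^ l2)%N by rewrite expn_gt0.
have sub j : (j < 2 ^ l1)%N -> (i + 2 ^ l2 * j < 2 ^ l1 * 2 ^ l2)%N by nia.
have xsi : (x + N + s * i < S)%N by apply: xS; move: (sub 0 p1); lia.
have sN2 : (s * 2 ^ l2 <= N)%N by nia.
have eN2 : (e * 2 ^ l2 <= N)%N by nia.
have gN2 : (g * 2 ^ l2 <= N * N)%N by nia.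
have mlt : ((g * 2 ^ l2) %% N < N)%N by rewrite ltn_mod.
eapply runs_bound.
- apply: runs_arith => /=; first by lia.
  apply: runs_arith => /=; first by lia.
  apply: runs_arith => /=; first by nia.
  apply: runs_arith => /=; first by lia.
  apply: runs_arith => /=; first by nia.
  apply: runs_arith => /=; first by nia.
  apply: runs_call_seq; rewrite /enter /=.
  + apply: (IH m l1 c) => //.
    * by rewrite -MN; ring.
    * by rewrite muln_gt0 s0.
    * by rewrite -mulnA [(2 ^ l2 * _)%N]mulnC.
    * by lia.
    * move=> j /sub /xS; lia.
  + by move=> a H; exact: H.
  + by move=> a H; exact: H.
  by move=> fr2 m2 q2 u2; apply: runs_skip.
- lia.
- lia.
Qed.

(** Row i is contiguous up to the stride s. Its twiddle factors w ^ (j * e * i) need no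
    multiplication of their own: they turn the twist g into g + e * i. *)
Lemma runs_row (k : nat) (m : memory R) (l1 l2 c x s g e i : nat) :
  fft_correct k ->
  table m -> (2 ^ l1 * 2 ^ l2 * e = N)%N -> (0 < s)%N ->
  (s * (2 ^ l1 * 2 ^ l2) <= N)%N -> (g < N)%N -> (2 * N <= x)%N -> (k < W)%N ->
  (forall j, (j < 2 ^ l1 * 2 ^ l2)%N -> (x + N + s * j < S)%N) ->
  (l2 <= c * 2 ^ k)%N -> (i < 2 ^ l1)%N ->
  runs (proc 8)
    (call_frame [:: i; l2; k; x; s; g; e; N; 2 ^ l1; 2 ^ l2] [::])%N m
    (fun a => fft_cells N (x + s * (2 ^ l2 * i)) s (2 ^ l2) a \/ in_table a)
    (fft_cells N (x + s * (2 ^ l2 * i)) s (2 ^ l2))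
    (2 ^ l2 * fft_work c k + 9)%N (fft_span l2 k + 9)%N
    (fun fr' m' => complexes fr' 0 = 0 /\
      forall i2, (i2 < 2 ^ l2)%N -> m' (x + s * (2 ^ l2 * i) + s * i2)%N =
      \sum_(0 <= j < 2 ^ l2) m (x + s * (2 ^ l2 * i) + s * j)%N *
        w ^+ (j * ((g + e * i) %% N + e * 2 ^ l1 * i2))).
Proof.
move=> IH tab MN s0 sM gN xN kW xS lc lti.
have e0 : (0 < e)%N by case: (e) MN N0 => //; rewrite muln0 => <-.
have p1 : (0 < 2 ^ l1)%N by rewrite expn_gt0.
have p2 : (0 < 2 ^ l2)%N by rewrite expn_gt0.
have sub j : (j < 2 ^ l2)%N -> (2 ^ l2 * i + j < 2 ^ l1 * 2 ^ l2)%N by nia.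
have xsi : (x + N + s * (2 ^ l2 * i) < S)%N by apply: xS; move: (sub 0 p2); lia.
have le : (2 ^ l2 * i <= s * (2 ^ l2 * i))%N by exact: leq_pmull.
have sN2 : (s * 2 ^ l2 <= N)%N by nia.
have eN1 : (e * 2 ^ l1 <= N)%N by nia.
have eiN : (e * i <= N)%N by nia.
have mlt : ((g + e * i) %% N < N)%N by rewrite ltn_mod.
eapply runs_bound.
- apply: runs_arith => /=; first by lia.
  apply: runs_arith => /=; first by lia.
  apply: runs_arith => /=; first by lia.
  apply: runs_arith => /=; first by nia.
  apply: runs_arith => /=; first by nia.
  apply: runs_arith => /=; first by nia.
  apply: runs_arith => /=; first by nia.
  apply: runs_call_seq; rewrite /enter /=.
  + apply: (IH m l2 c) => //.
    * by rewrite -MN; ring.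
    * by lia.
    * move=> j /sub /xS; lia.
  + by move=> a H; exact: H.
  + by move=> a H; exact: H.
  by move=> fr2 m2 q2 u2; apply: runs_skip.
- lia.
- lia.
Qed.

Lemma runs_fftS (k : nat) : fft_correct k -> fft_correct k.+1.
Proof.
move=> IH m l c x s g e tab MN s0 sM gN xN kW xS lc.
have e0 : (0 < e)%N by case: (e) MN N0 => //; rewrite muln0 => <-.
have MN' : (2 ^ l <= N)%N by rewrite -MN leq_pmulr.
have lM : (l < 2 ^ l)%N by exact: ltn_expl.
have MW : (2 ^ l < W)%N by nia.
pose l1 := (l %/ 2)%N; pose l2 := (l - l1)%N.
have lE : (l1 + l2 = l)%N by rewrite /l2 /l1; lia.
have ME : (2 ^ l = 2 ^ l1 * 2 ^ l2)%N by rewrite -expnD lE.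
have lc1 : (l1 <= c * 2 ^ k)%N by rewrite expnS in lc; rewrite /l1; nia.
have lc2 : (l2 <= c * 2 ^ k)%N by rewrite expnS in lc; rewrite /l2 /l1; nia.
have p1 : (0 < 2 ^ l1)%N by rewrite expn_gt0.
have p2 : (0 < 2 ^ l2)%N by rewrite expn_gt0.
have M1 : (2 ^ l1 <= 2 ^ l)%N by rewrite ME leq_pmulr.
have M2 : (2 ^ l2 <= 2 ^ l)%N by rewrite ME leq_pmull.
have colsub i j : (i < 2 ^ l2)%N -> (j < 2 ^ l1)%N ->
    (i + 2 ^ l2 * j < 2 ^ l)%N by rewrite ME; nia.
have rowsub i j : (i < 2 ^ l1)%N -> (j < 2 ^ l2)%N ->
    (2 ^ l2 * i + j < 2 ^ l)%N by rewrite ME; nia.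
have sj j : (j < 2 ^ l)%N -> (s * j < N)%N.
  by move=> lj; apply: leq_trans sM; rewrite ltn_pmul2l.
(* The index of a cell in column i is i modulo 2 ^ l2, and the index of a cell in row i has quotient
   i. Disjointness of columns and of rows thus follows from the injectivity of the cell
   numbering. *)
have colcells i a : (i < 2 ^ l2)%N ->
    fft_cells N (x + s * i) (s * 2 ^ l2) (2 ^ l1) a ->
    exists j, [/\ (j < 2 ^ l)%N, (j %% 2 ^ l2 = i)%N &
      a = (x + s * j)%N \/ a = (x + N + s * j)%N].
  move=> lti [j ltj h]; exists (i + 2 ^ l2 * j)%N; split; first exact: colsub.
    by rewrite mulnC addnC modnMDl modn_small.
  by rewrite mulnDr mulnA; lia.
have rowcells i a : (i < 2 ^ l1)%N ->
    fft_cells N (x + s * (2 ^ l2 * i)) s (2 ^ l2) a ->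
    exists j, [/\ (j < 2 ^ l)%N, (j %/ 2 ^ l2 = i)%N &
      a = (x + s * j)%N \/ a = (x + N + s * j)%N].
  move=> lti [j ltj h]; exists (2 ^ l2 * i + j)%N; split; first exact: rowsub.
    by rewrite mulnC divnMDl // divn_small // addn0.
  by rewrite mulnDr; lia.
have tabF j a : a = (x + s * j)%N \/ a = (x + N + s * j)%N -> in_table a ->
  False.
  by rewrite /in_table; lia.
have coldis i j a : (i < 2 ^ l2)%N -> (j < 2 ^ l2)%N ->
    fft_cells N (x + s * i) (s * 2 ^ l2) (2 ^ l1) a ->
    fft_cells N (x + s * j) (s * 2 ^ l2) (2 ^ l1) a -> i = j.
  move=> lti ltj /(colcells _ _ lti) [i' [bi <- ai]].
  move=> /(colcells _ _ ltj) [j' [bj <- aj]].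
  by rewrite (fft_cells_inj s0 sM bi bj ai aj).
have rowdis i j a : (i < 2 ^ l1)%N -> (j < 2 ^ l1)%N ->
    fft_cells N (x + s * (2 ^ l2 * i)) s (2 ^ l2) a ->
    fft_cells N (x + s * (2 ^ l2 * j)) s (2 ^ l2) a -> i = j.
  move=> lti ltj /(rowcells _ _ lti) [i' [bi <- ai]].
  move=> /(rowcells _ _ ltj) [j' [bj <- aj]].
  by rewrite (fft_cells_inj s0 sM bi bj ai aj).
have colcell i a : (i < 2 ^ l2)%N ->
    fft_cells N (x + s * i) (s * 2 ^ l2) (2 ^ l1) a ->
    fft_cells N x s (2 ^ l) a.
  by move=> lti /(colcells _ _ lti) [j [ltj _ h]]; exists j.
have rowcell i a : (i < 2 ^ l1)%N ->
    fft_cells N (x + s * (2 ^ l2 * i)) s (2 ^ l2) a ->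
    fft_cells N x s (2 ^ l) a.
  by move=> lti /(rowcells _ _ lti) [j [ltj _ h]]; exists j.
have modp p : (p %% 2 ^ l1 < 2 ^ l1)%N by rewrite ltn_mod.
have divp p : (p < 2 ^ l)%N -> (p %/ 2 ^ l1 < 2 ^ l2)%N.
  by move=> ltp; rewrite ltn_divLR // mulnC -ME.
pose y i := \sum_(0 <= j < 2 ^ l) m (x + s * j)%N * w ^+ (j * (g + e * i)).
eapply runs_bound.
- apply: runs_call_seq; rewrite /enter /=.
  + by apply: runs_pow2.
  + by move=> a H; exact: H.
  + by move=> a H; exact: H.
  move=> fr1 m1 [e1 ->] _.
  apply: runs_const; first by lia.
  apply: runs_const; first by lia.
  apply: (@runs_seq _ _ _ _ _ _ _ _ _ _ _ _ _ _ (fun fr2 m2 =>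
      enter fr2 (Invocation 11 [:: 9; 7; 2; 3; 6] [::] 16 0)%N =
        call_frame [:: 0; 2 ^ l; x; s; N]%N [::] /\
      forall i, (i < 2 ^ l)%N -> m2 (x + N + s * i)%N = y i)).
    apply: runs_ifF => //=.
    apply: runs_const; first by lia.
    apply: runs_arith => /=; first by lia.
    apply: runs_arith => /=; first by lia.
    rewrite -/l1 -/l2.
    apply: runs_call_seq; rewrite /enter /=.
    + by apply: runs_pow2; lia.
    + by move=> a H; exact: H.
    + by move=> a H; exact: H.
    move=> fr2 m2 [e2 ->] _.
    apply: runs_call_seq; rewrite /enter /=.
    + by apply: runs_pow2; lia.
    + by move=> a H; exact: H.
    + by move=> a H; exact: H.
    move=> fr3 m3 [e3 ->] _.
    apply: runs_arith => /=; first by lia.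
    rewrite subn1 /=.
    apply: runs_call_seq; rewrite /enter /= ?e1 ?e2 ?e3.
    + apply: (@runs_par_for _ _ _ _ 5 6 [:: l1; k; x; s; g; e; N; (2 ^ l2)%N] _
        (fun i a => fft_cells N (x + s * i) (s * 2 ^ l2) (2 ^ l1) a \/
          in_table a)%N
        (fun i a => fft_cells N (x + s * i) (s * 2 ^ l2) (2 ^ l1) a)%N _ _
        _ (fun i m' => forall i1, (i1 < 2 ^ l1)%N ->
          m' (x + s * i + s * 2 ^ l2 * i1)%N =
          \sum_(0 <= j < 2 ^ l1) m (x + s * i + s * 2 ^ l2 * j)%N *
            w ^+ (j * ((g * 2 ^ l2) %% N + e * 2 ^ l2 * i1))) l2) => //=.
      * by rewrite expn_gt0 leqnn.
      * by lia.
      * move=> i ma mb lti H h i1 lt1; rewrite -H ?h //.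
        by exists i1 => //; left.
      * move=> i j a lti ltj ne h [[h'|]|h'].
        -- exact: ne (coldis _ _ _ lti ltj h h').
        -- by have [i' [_ _ ai]] := colcells _ _ lti h; exact: tabF ai.
        -- exact: ne (coldis _ _ _ lti ltj h h').
      * move=> i lti; apply: (@runs_column k m l1 l2 c) => //; rewrite -?ME //;
          lia.
    + by move=> a [i lti [h|h]]; [left; exact: colcell lti h|right].
    + by move=> a [i lti h]; exact: colcell lti h.
    move=> fr4 m4 [_ q4] u4.
    have tab4 : table m4.
      move=> p ltp; rewrite u4 ?tab // => -[i lti h].
      have [i' [_ _ ai]] := colcells _ _ lti h.
      by apply: (tabF _ _ ai); rewrite /in_table; lia.
    apply: runs_call_seq; rewrite /enter /= ?e1 ?e2 ?e3.
    + apply: (@runs_par_for _ _ _ _ 7 8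
        [:: l2; k; x; s; g; e; N; (2 ^ l1)%N; (2 ^ l2)%N] _
        (fun i a => fft_cells N (x + s * (2 ^ l2 * i)) s (2 ^ l2) a \/
          in_table a)%N
        (fun i a => fft_cells N (x + s * (2 ^ l2 * i)) s (2 ^ l2) a)%N _ _
        _ (fun i m' => forall i2, (i2 < 2 ^ l2)%N ->
          m' (x + s * (2 ^ l2 * i) + s * i2)%N =
          \sum_(0 <= j < 2 ^ l2) m4 (x + s * (2 ^ l2 * i) + s * j)%N *
            w ^+ (j * ((g + e * i) %% N + e * 2 ^ l1 * i2))) l1) => //=.
      * by rewrite expn_gt0 leqnn.
      * by lia.
      * move=> i ma mb lti H h i2 lt2; rewrite -H ?h //.
        by exists i2 => //; left.
      * move=> i j a lti ltj ne h [[h'|]|h'].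
        -- exact: ne (rowdis _ _ _ lti ltj h h').
        -- by have [i' [_ _ ai]] := rowcells _ _ lti h; exact: tabF ai.
        -- exact: ne (rowdis _ _ _ lti ltj h h').
      * move=> i lti; apply: (@runs_row k m4 l1 l2 c) => //; rewrite -?ME //;
          lia.
    + by move=> a [i lti [h|h]]; [left; exact: rowcell lti h|right].
    + by move=> a [i lti h]; exact: rowcell lti h.
    move=> fr5 m5 [_ q5] u5.
    apply: runs_call_seq; rewrite /enter /= ?e1 ?e2 ?e3.
    + apply: (@runs_par_for _ _ _ _ 9 10 [:: x; s; N; (2 ^ l1)%N; (2 ^ l2)%N] _
        (fun p a => a = x + s * (2 ^ l2 * (p %% 2 ^ l1) + p %/ 2 ^ l1))%N
        (fun p a => a = x + N + s * p)%N _ _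
        _ (fun p m' => m' (x + N + s * p)%N =
          m5 (x + s * (2 ^ l2 * (p %% 2 ^ l1) + p %/ 2 ^ l1))%N) l) => //=.
      * by rewrite expn_gt0 leqnn.
      * exact: ltnW.
      * by move=> p ma mb ltp H; rewrite -H.
      * move=> p p' a ltp ltp' ne -> [h|/eqP].
          have := sj _ (rowsub _ _ (modp p') (divp _ ltp')).
          by have := sj _ ltp; lia.
        by rewrite eqn_add2l eqn_pmul2l // => /eqP.
      * by move=> p ltp; apply: runs_transpose; rewrite -?ME //; exact: xS.
    + move=> a [p ltp ->]; left;
        exists (2 ^ l2 * (p %% 2 ^ l1) + p %/ 2 ^ l1)%N.
        exact: rowsub (modp p) (divp _ ltp).
      by left.
    + by move=> a [p ltp ->]; exists p => //; right.
    move=> fr6 m6 [_ q6] u6; apply: runs_skip; split.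
      by rewrite /enter /= e1.
    move=> p ltp; rewrite q6 // mulnDr addnA q5; [|exact: modp|exact: divp].
    (* The output index splits as p = i1 + 2 ^ l1 * i2, by remainder and quotient; the right-hand
       side of the Cooley-Tukey identity is then [y p]. *)
    have NE : (2 ^ l1 * 2 ^ l2 * e)%N = N by rewrite -ME.
    have := cooley_tukey g (p %% 2 ^ l1) (p %/ 2 ^ l1)
      (fun j => m (x + s * j)%N) wN NE.
    rewrite [(p %% _ + _ * _)%N]addnC [(2 ^ l1 * (p %/ _))%N]mulnC -divn_eq.
    rewrite -ME -/(y p) => <-.
    apply: eq_big_nat => j2 /andP[_ lt2]; congr (_ * _).
    have -> : (x + s * (2 ^ l2 * (p %% 2 ^ l1)) + s * j2 =
      x + s * j2 + s * 2 ^ l2 * (p %% 2 ^ l1))%N by rewrite -mulnA; lia.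
    rewrite q4 //.
    apply: eq_big_nat => j1 /andP[_ lt1]; congr (m _ * _).
    by rewrite -mulnA; lia.
  move=> fr2 m2 [frE q2]; apply: runs_fft_copy frE q2 _ => //.
  by move=> a h; left.
- have F2 : (2 ^ l2 * (2 ^ l1 * fft_work c k + 8 + 15) =
      2 ^ l * fft_work c k + 23 * 2 ^ l2)%N by rewrite ME; ring.
  have F1 : (2 ^ l1 * (2 ^ l2 * fft_work c k + 9 + 15) =
      2 ^ l * fft_work c k + 24 * 2 ^ l1)%N by rewrite ME; ring.
  have -> : (2 ^ l * fft_work c k.+1 = 2 * (2 ^ l * fft_work c k) + 400 * 2 ^
    l)%N.
    by rewrite fft_workS; ring.
  by rewrite F1 F2; lia.
(* Since l1 + l2 = l, running the two passes in sequence does not double the part of the span that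
   is linear in l. *)
- have : (100 * l1 * k.+1 + 100 * l2 * k.+1 = 100 * l * k.+1)%N.
    by rewrite -lE; ring.
  have : (100 * l * k.+2 = 100 * l * k.+1 + 100 * l)%N by rewrite mulnSr.
  have : (0 < 2 ^ k.+1)%N by rewrite expn_gt0.
  by rewrite /fft_span [(2 ^ k.+2)%N]expnS; lia.
Qed.

Lemma runs_fft (k : nat) : fft_correct k.
Proof. by elim: k => [|k IH]; [exact: runs_fft0|exact: runs_fftS]. Qed.

End Transform.

(** * Reduction of arbitrary lengths *)

(** The order divides 2 ^ l, so a smaller order would divide 2 ^ (l - 1); but the power with
    exponent 2 ^ (l - 1) is cos pi = -1. Hence no injectivity of sine or cosine has to be
    discussed. *)
Lemma root_unity_prim (R : realType) (l : nat) :
  (2 ^ l).-primitive_root (root_unity R (2 ^ l)).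
Proof.
have N0 : (0 < 2 ^ l)%N by rewrite expn_gt0.
have [M primM dvdM] := prim_order_exists N0 (root_unity_exp_eq1 R N0).
have /(dvdn_pfactor _ _ (isT : prime 2))[j lej ME] := dvdM.
move: lej; rewrite leq_eqVlt => /orP[/eqP jl|ltj].
  by rewrite -{1}jl -ME.
case: l => [//|l] in N0 primM dvdM ltj *.
have : (M %| 2 ^ l)%N by rewrite ME dvdn_exp2l.
rewrite (prim_order_dvd primM) root_unity_exp => /eqP E.
suff : (-1 : R[i]) = 1 by move/eqP;
  rewrite -subr_eq0 -opprD oppr_eq0 -mulr2n pnatr_eq0.
rewrite -[RHS]E expnS natrM.
have -> : (2 ^ l)%:R * (2 * pi / (2%:R * (2 ^ l)%:R)) = pi :> R.
  have h0 : (2 ^ l)%:R != 0 :> R by rewrite pnatr_eq0 expn_eq0.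
  by field.
by rewrite cospi sinpi; apply/eqP; rewrite eq_complex /= oppr0 !eqxx.
Qed.

Lemma sum_prim_root (K : fieldType) (w : K) (N d : nat) :
  N.-primitive_root w ->
  \sum_(0 <= k < N) w ^+ (k * d) = if (N %| d)%N then N%:R else 0.
Proof.
move=> prim; rewrite big_mkord; case: ifPn => dvd.
  rewrite (eq_bigr (fun _ => 1)) ?sumr_const ?card_ord // => k _.
  by rewrite mulnC exprM; move: dvd; rewrite (prim_order_dvd prim) => /eqP ->;
    rewrite expr1n.
have ne : w ^+ d - 1 != 0 by rewrite subr_eq0 -(prim_order_dvd prim).
apply: (mulfI ne); rewrite mulr0.
transitivity (w ^+ d ^+ N - 1); last first.
  by rewrite -exprM mulnC exprM (prim_expr_order prim) expr1n subrr.
by rewrite [RHS]subrX1; congr (_ * _); apply: eq_bigr => k _;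
  rewrite -exprM mulnC.
Qed.

(** Reading the second spectrum at N - k turns convolution into correlation, so all three transforms
    use nonnegative powers of the same w and one procedure serves them. The support condition on u
    excludes wrap-around. *)
Lemma dft_correlation (K : fieldType) (w : K) (N i : nat) (u v : nat -> K) :
  N.-primitive_root w ->
  (forall p, (p < N)%N -> u p != 0 -> (p + i < N)%N) ->
  \sum_(0 <= k < N)
    ((\sum_(0 <= p < N) u p * w ^+ (p * k)) *
     (\sum_(0 <= s < N) v s * w ^+ (s * ((N - k) %% N)))) * w ^+ (k * i) =
  N%:R * \sum_(0 <= p < N) u p * v (p + i)%N.
Proof.
move=> prim ui; have N0 := prim_order_gt0 prim.
have wN := prim_expr_order prim.
have w0 : w != 0.
  by apply/eqP => w0; move: wN; rewrite w0 expr0n eqn0Ngt N0 => /eqP;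
    rewrite eq_sym oner_eq0.
transitivity (\sum_(0 <= p < N) \sum_(0 <= s < N) u p * v s *
    \sum_(0 <= k < N) w ^+ (k * (p + i + (N - s)))).
  under eq_bigr do rewrite big_distrl big_distrl /=.
  rewrite exchange_big; apply: eq_bigr => p _ /=.
  under eq_bigr do rewrite big_distrr big_distrl /=.
  rewrite exchange_big; apply: eq_big_nat => s /andP[_ ls] /=.
  rewrite big_distrr; apply: eq_big_nat => k /andP[_ lk] /=.
  rewrite mulrACA -[LHS]mulrA; congr (_ * _).
  have E : w ^+ (s * ((N - k) %% N)) = w ^+ (k * (N - s)).
    rewrite mulnC exprM (expr_mod _ wN) -exprM.
    (* Multiplying by w ^ (s * k) makes both exponents multiples of N and removes the truncated
       subtractions. *)
    apply: (mulIf (expf_neq0 (s * k) w0)); rewrite -!exprD.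
    have -> : ((N - k) * s + s * k = N * s)%N by nia.
    have -> : (k * (N - s) + s * k = N * k)%N by nia.
    by rewrite !exprM wN !expr1n.
  by rewrite E -!exprD; congr (_ ^+ _); ring.
rewrite big_distrr; apply: eq_big_nat => p /andP[_ lp] /=.
have [->|up] := eqVneq (u p) 0.
  by rewrite mul0r mulr0 big1 // => s _; rewrite !mul0r.
have pi := ui p lp up.
rewrite (bigD1_seq (p + i)%N) ?mem_index_iota ?iota_uniq //=.
rewrite sum_prim_root // subnKC ?dvdnn; last exact: ltnW.
rewrite big_seq_cond big1 => [|s]; first by rewrite addr0; ring.
rewrite mem_index_iota => /andP[/andP[_ ls] ne].
(* As p + i < N and s < N, the number p + i + (N - s) lies strictly between 0 and 2 N; a multiple of
   N there must be N itself, which forces s = p + i. *)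
rewrite sum_prim_root // ifF ?mulr0 //; apply/negP => /dvdnP[q Eq].
have : (q = 1)%N by nia.
by move=> q1; move/eqP: ne; apply; lia.
Qed.

(** This is 'C(p, 2). In contrast to p ^ 2 / 2 it is always an integer, so powers of w_n itself
    suffice for odd and even n alike. *)
Definition chirp (p : nat) : nat := (p * (p - 1) %/ 2)%N.

Lemma chirpS (p : nat) : chirp p.+1 = (chirp p + p)%N.
Proof.
rewrite /chirp subSS subn0; case: p => [//|p]; rewrite subSS subn0.
have -> : (p.+2 * p.+1 = p.+1 * p + p.+1 * 2)%N by lia.
by rewrite divnDMl.
Qed.

Lemma chirpD (p i : nat) : chirp (p + i) = (chirp p + chirp i + i * p)%N.
Proof.
elim: i => [|i IH]; first by rewrite addn0 mul0n addn0 addn0.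
by rewrite addnS !chirpS IH; lia.
Qed.

(** The chirped input vanishes from n on and i < n, so the sums p + i stay below 2 n <= N and the
    cyclic correlation equals the ordinary one. *)
Lemma bluestein (K : fieldType) (z w : K) (n N i : nat) (a : nat -> K) :
  z != 0 -> N%:R != 0 :> K -> N.-primitive_root w -> (i < n)%N -> (n + n <=
    N)%N ->
  (\sum_(0 <= k < N)
    ((\sum_(0 <= p < N)
       (if (p < n)%N then a p * z ^+ chirp p else 0) * w ^+ (p * k)) *
     (\sum_(0 <= s < N) z ^- chirp s * w ^+ (s * ((N - k) %% N)))) *
     w ^+ (k * i)) * z ^+ chirp i / N%:R =
  \sum_(0 <= j < n) a j * z ^- (i * j).
Proof.
move=> z0 N0 prim lin nN.
rewrite dft_correlation //; last first.
  by move=> p lp; case: ifP => h; [move=> _; lia|rewrite eqxx].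
rewrite mulrC mulrA mulrA mulVf // mul1r big_distrl /=.
rewrite (@big_cat_nat _ _ _ n) //=; last by lia.
rewrite [X in _ + X]big_nat_cond [X in _ + X]big1 => [|p]; last first.
  by move=> /andP[/andP[h _] _]; rewrite ltnNge h /= !mul0r.
rewrite addr0; apply: eq_big_nat => p /andP[_ lp]; rewrite lp chirpD.
by rewrite !exprD; field; rewrite !expf_neq0.
Qed.

(** * The main procedure *)

Section Main.
Context (R : realType) (W n l : nat).
Local Notation N := (2 ^ l)%N.
Hypothesis NW : (2 * N * N < W)%N.
Hypothesis n4 : (4 <= n)%N.
Hypothesis nN : (2 * n <= N)%N.
(** Memory in blocks of N cells: block 0 holds input and output, which fit since 2 n <= N; block 1
    the powers of w; blocks 2 and 3 the chirped input and its scratch; blocks 4 and 5 the inverse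
    chirp and its scratch. *)
Local Notation S := (6 * N)%N.
Local Notation runs := (runs fft_program W S).
Local Notation proc := (nth Skip fft_program).
Local Notation z := (root_unity R n).
Local Notation w := (root_unity R N).

Lemma chirp_bound (p : nat) : (p < N)%N -> (chirp p < 2 ^ (2 * l))%N.
Proof.
move=> lp; rewrite mul2n -addnn expnD /chirp.
have : (p * (p - 1) < N * N)%N by nia.
by lia.
Qed.

Definition chirped (m : memory R) (p : nat) : R[i] :=
  if (p < n)%N then m p * z ^+ chirp p else 0.

Lemma runs_init (m : memory R) (p : nat) :
  (p < N)%N ->
  runs (proc 18) (call_frame [:: p; n; N]%N [::]) m
    (fun a => a < n)%N
    (fun a => [\/ a = N + p, a = 2 * N + p | a = 4 * N + p])%N
    (45 * l + 60)%N (45 * l + 60)%N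
    (fun fr' m' => complexes fr' 0 = 0 /\
      [/\ m' (N + p)%N = w ^+ p, m' (2 * N + p)%N = chirped m p &
          m' (4 * N + p)%N = z ^- chirp p]).
Proof.
move=> lp; have cp := chirp_bound lp.
have cW : (p * (p - 1) < N * N)%N by nia.
have cE : (2 ^ (2 * l) = N * N)%N by rewrite mul2n -addnn expnD.
eapply runs_bound.
- apply: runs_root => /=.
  apply: runs_call_seq; rewrite /enter /=.
  + apply: (@runs_power _ _ _ _ l) => //; nia.
  + by move=> a H; exact: H.
  + by move=> a H; exact: H.
  move=> fr1 m1 [e1 ->] _.
  apply: runs_arith => /=; first by nia.
  apply: runs_write => /=; [by lia|by constructor 1|].
  apply: runs_const; first by nia.
  apply: runs_arith => /=; first by nia.
  apply: runs_arith => /=; first by nia.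
  apply: runs_const; first by nia.
  apply: runs_arith => /=; first by lia.
  rewrite -/(chirp p).
  apply: runs_root => /=.
  apply: runs_call_seq; rewrite /enter /=.
  + apply: (@runs_power _ _ _ _ (2 * l)) => //; lia.
  + by move=> a H; exact: H.
  + by move=> a H; exact: H.
  move=> fr2 m2 [e2 ->] _.
  apply: runs_const; first by nia.
  apply: runs_root => /=.
  apply: runs_complex => /=.
  apply: runs_arith => /=; first by nia.
  apply: runs_arith => /=; first by nia.
  apply: runs_arith => /=; first by nia.
  apply: runs_arith => /=; first by nia.
  apply: runs_write => /=; [by lia|by constructor 3; lia|].
  rewrite e1 e2 root_unity1 div1r.
  have -> : (N + N + (N + N) + p = 4 * N + p)%N by lia.
  have -> : (N + N + p = 2 * N + p)%N by lia.
  apply: runs_last; apply: runs_if => /= h.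
    apply: runs_read => /=; [by lia|by []|].
    apply: runs_complex => /=.
    apply: runs_write => /=; [by lia|by constructor 2|].
    apply: runs_skip; split=> //; rewrite /chirped h /=.
    by split; repeat first [rewrite ifT; last by lia | rewrite ifF; last
      by lia];
      rewrite ?e2.
  (* The padding value is the content of complex register 7, still 0 from the start. *)
  apply: runs_write => /=; [by lia|by constructor 2|].
  apply: runs_skip; split=> //; rewrite /chirped ltnNge h /=.
  by split; repeat first [rewrite ifT; last by lia | rewrite ifF; last by lia];
      rewrite ?e2.
- lia.
- lia.
Qed.

Lemma runs_product (m : memory R) (p : nat) :
  (p < N)%N ->
  runs (proc 20) (call_frame [:: p; N]%N [::]) m
    (fun a => a = 2 * N + p \/ a = 4 * N + (N - p) %% N)%N
    (fun a => a = 2 * N + p)%N 11 11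
    (fun fr' m' => complexes fr' 0 = 0 /\
      m' (2 * N + p)%N = m (2 * N + p)%N * m (4 * N + (N - p) %% N)%N).
Proof.
move=> lp; have mp : ((N - p) %% N < N)%N by rewrite ltn_mod; lia.
apply: runs_arith => /=; first by nia.
apply: runs_arith => /=; first by nia.
apply: runs_arith => /=; first by nia.
apply: runs_arith => /=; first by nia.
apply: runs_arith => /=; first by nia.
apply: runs_arith => /=; first by nia.
have -> : (N + N + p = 2 * N + p)%N by lia.
have -> : (N + N + (N + N) + (N - p) %% N = 4 * N + (N - p) %% N)%N by lia.
apply: runs_read => /=; [by lia|by left|].
apply: runs_read => /=; [by lia|by right|].
apply: runs_complex => /=.
apply: runs_write => //=; first by lia.
by apply: runs_skip => /=; rewrite eqxx.
Qed.

Lemma runs_output (m : memory R) (i : nat) :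
  (i < n)%N ->
  runs (proc 22) (call_frame [:: i; n; N; l]%N [::]) m
    (fun a => a = 2 * N + i)%N (fun a => a = n + i)%N
    (45 * l + 60)%N (45 * l + 60)%N
    (fun fr' m' => complexes fr' 0 = 0 /\
      m' (n + i)%N = m (2 * N + i)%N * z ^+ chirp i / N%:R).
Proof.
move=> li; have lp : (i < N)%N by lia.
have cp := chirp_bound lp.
have cW : (i * (i - 1) < N * N)%N by nia.
have cE : (2 ^ (2 * l) = N * N)%N by rewrite mul2n -addnn expnD.
have lN : (l < N)%N by exact: ltn_expl.
eapply runs_bound.
- apply: runs_const; first by nia.
  apply: runs_arith => /=; first by nia.
  apply: runs_arith => /=; first by nia.
  apply: runs_const; first by nia.
  apply: runs_arith => /=; first by lia.
  rewrite -/(chirp i).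
  apply: runs_root => /=.
  apply: runs_call_seq; rewrite /enter /=.
  + apply: (@runs_power _ _ _ _ (2 * l)) => //; lia.
  + by move=> a H; exact: H.
  + by move=> a H; exact: H.
  move=> fr1 m1 [e1 ->] _.
  (* Words cannot be converted to complex numbers, so the divisor N is computed as (w_1 + w_1) ^
     l. *)
  apply: runs_root => /=.
  apply: runs_complex => /=.
  apply: runs_call_seq; rewrite /enter /=.
  + apply: (@runs_power _ _ _ _ l) => //; nia.
  + by move=> a H; exact: H.
  + by move=> a H; exact: H.
  move=> fr2 m2 [e2 ->] _.
  apply: runs_arith => /=; first by nia.
  apply: runs_arith => /=; first by nia.
  have -> : (N + N + i = 2 * N + i)%N by lia.
  apply: runs_read => //=; first by lia.
  apply: runs_complex => /=.
  apply: runs_complex => /=.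
  apply: runs_arith => /=; first by nia.
  apply: runs_write => //=; first by lia.
  apply: runs_skip => /=; rewrite eqxx e1 e2 root_unity1; split=> //.
  by rewrite -[1 + 1]/(2%:R) natrX.
- lia.
- lia.
Qed.

Hypothesis lE : l = (trunc_log 2 n + 2)%N.

Lemma runs_main (m : memory R) (q c : nat) :
  let k := (trunc_log 2 (q * trunc_log 2 q) + 2)%N in
  (2 <= q <= n)%N -> (l <= c * 2 ^ k)%N ->
  runs (proc 0) (call_frame [:: n; q]%N [::]) m
    (fun _ => True) (fun _ => True)
    (N * (3 * fft_work c k + 300 * l + 300))%N
    (3 * fft_span l k + 400 * l + 400)%N
    (fun fr' m' => forall i, (i < n)%N ->
      m' (n + i)%N = \sum_(0 <= j < n) m j * z ^- (i * j)).
Proof.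
move=> k /andP[q2 qn] lc.
have NNW : (N * N < W)%N by nia.
have SW : (6 * N <= W)%N by nia.
have NW1 : (N < W)%N by lia.
have nW : (n < W)%N by lia.
have nlt := ltn_expl n (isT : (1 < 2)%N).
have lN : (l < N)%N by exact: ltn_expl.
have logn : (trunc_log 2 n <= l)%N by rewrite lE leq_addr.
have lq : (trunc_log 2 q <= l)%N by apply: leq_trans (leq_trunc_log _ qn) logn.
have qlq : (q * trunc_log 2 q < N * N)%N by nia.
have lqlq : (trunc_log 2 (q * trunc_log 2 q) <= 2 * l)%N.
  rewrite -[X in (_ <= X)%N](@trunc_expnK 2) //; apply: leq_trunc_log.
  by rewrite mul2n -addnn expnD ltnW.
have kW : (k < W)%N by rewrite /k; nia.
have p1 : N.-primitive_root w by exact: root_unity_prim.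
(* With stride 1 the cells written form the interval from x to x + 2 N, so the table and the other
   array survive each transform. *)
have FFT (x : nat) (mm : memory R) : table N w mm -> (2 * N <= x)%N ->
    (x + 2 * N <= S)%N ->
    runs (proc 4) (call_frame [:: l; k; x; 1; 0; 1; N]%N [::]) mm
      (fun _ => True) (fun a => x <= a < x + 2 * N)%N
      (N * fft_work c k) (fft_span l k)
      (fun _ m' => forall i, (i < N)%N ->
        m' (x + i)%N = \sum_(0 <= j < N) mm (x + j)%N * w ^+ (j * i)).
  move=> tab xN xS.
  have : runs (proc 4) (call_frame [:: l; k; x; 1; 0; 1; N]%N [::]) mm
      (fun a => fft_cells N x 1 N a \/ in_table N a) (fft_cells N x 1 N)
      (N * fft_work c k) (fft_span l k)
      (fun _ m' => forall i, (i < N)%N -> m' (x + 1 * i)%N =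
        \sum_(0 <= j < N) mm (x + 1 * j)%N * w ^+ (j * (0 + 1 * i))).
    apply: (@runs_fft R W S N w) => //; try nia.
    exact: prim_expr_order.
  move=> H; apply: runs_weaken H _ _ _ _ _ => //.
    by move=> a [j ltj []->]; lia.
  move=> _ m' H i lti; rewrite -[X in (x + X)%N]mul1n H //.
  by apply: eq_bigr => j _; rewrite add0n !mul1n.
eapply runs_bound.
- apply: runs_call_seq; rewrite /enter /=.
  + by apply: runs_log; lia.
  + by move=> a H; exact: H.
  + by move=> a H; exact: H.
  move=> fr1 m1 [e1 ->] _.
  apply: runs_const; first by lia.
  apply: runs_arith => /=; first by rewrite e1 -lE; nia.
  apply: runs_call_seq; rewrite /enter /= ?e1 -?lE.
  + by apply: runs_pow2; nia.
  + by move=> a H; exact: H.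
  + by move=> a H; exact: H.
  move=> fr2 m2 [e2 ->] _.
  apply: runs_call_seq; rewrite /enter /=.
  + by apply: runs_log; lia.
  + by move=> a H; exact: H.
  + by move=> a H; exact: H.
  move=> fr3 m3 [e3 ->] _.
  apply: runs_arith => /=; first by rewrite e3; nia.
  apply: runs_call_seq; rewrite /enter /= ?e3.
  + by apply: runs_log; nia.
  + by move=> a H; exact: H.
  + by move=> a H; exact: H.
  move=> fr4 m4 [e4 ->] _.
  apply: runs_arith => /=; rewrite ?e4 -/k; first by [].
  apply: runs_const; first by nia.
  apply: runs_const; first by nia.
  apply: runs_arith => /=; first by rewrite e2; nia.
  apply: runs_arith => /=; first by rewrite e2; nia.
  apply: runs_call_seq; rewrite /enter /= ?e2.
  + apply: (@runs_par_for _ _ _ _ 17 18 [:: n; N]%N _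
      (fun p a => a < n)%N
      (fun p a => [\/ a = N + p, a = 2 * N + p | a = 4 * N + p])%N _ _
      _ (fun p m' => [/\ m' (N + p)%N = w ^+ p,
        m' (2 * N + p)%N = chirped m p & m' (4 * N + p)%N = z ^- chirp p]) l)
      => //=.
    * by nia.
    * by rewrite expn_gt0 leqnn.
    * by nia.
    * move=> p ma mb lp H [h1 h2 h3]; split; rewrite -H //.
      - by constructor 1.
      - by constructor 2.
      - by constructor 3.
    * by move=> p p' a lp lp' ne []-> [|[]]; lia.
    * by move=> p lp; exact: runs_init.
  + by [].
  + by [].
  move=> fr5 m5 [_ q5] u5.
  have tab5 : table N w m5 by move=> p lp; have [] := q5 p lp.
  apply: runs_call_seq; rewrite /enter /= ?e1 ?e2 -?lE.
  + by apply: (FFT (2 * N)%N m5) => //; lia.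
  + by [].
  + by [].
  move=> fr6 m6 q6 u6.
  have tab6 : table N w m6 by move=> p lp; rewrite u6 ?tab5 //; lia.
  apply: runs_call_seq; rewrite /enter /= ?e1 ?e2 -?lE.
  + by apply: (FFT (2 * (2 * N))%N m6) => //; lia.
  + by [].
  + by [].
  move=> fr7 m7 q7 u7.
  have tab7 : table N w m7 by move=> p lp; rewrite u7 ?tab6 //; lia.
  apply: runs_call_seq; rewrite /enter /= ?e1 ?e2 -?lE.
  + apply: (@runs_par_for _ _ _ _ 19 20 [:: N]%N _
      (fun p a => a = 2 * N + p \/ a = 4 * N + (N - p) %% N)%N
      (fun p a => a = 2 * N + p)%N _ _
      _ (fun p m' => m' (2 * N + p)%N =
        m7 (2 * N + p)%N * m7 (4 * N + (N - p) %% N)%N) l) => //=.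
    * by nia.
    * by rewrite expn_gt0 leqnn.
    * by nia.
    * by move=> p ma mb lp H h; rewrite -H.
    * by move=> p p' a lp lp' ne -> [[]|]; lia.
    * by move=> p lp; exact: runs_product.
  + by [].
  + by [].
  move=> fr8 m8 [_ q8] u8.
  have tab8 : table N w m8.
    by move=> p lp; rewrite u8 ?tab7 // => -[p' lp']; lia.
  apply: runs_call_seq; rewrite /enter /= ?e1 ?e2 -?lE.
  + by apply: (FFT (2 * N)%N m8) => //; lia.
  + by [].
  + by [].
  move=> fr9 m9 q9 u9.
  apply: runs_call_seq; rewrite /enter /= ?e1 ?e2 -?lE.
  + apply: (@runs_par_for _ _ _ _ 21 22 [:: n; N; l]%N _
      (fun i a => a = 2 * N + i)%N (fun i a => a = n + i)%N _ _
      _ (fun i m' => m' (n + i)%N =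
        m9 (2 * N + i)%N * z ^+ chirp i / N%:R) l) => //=.
    * by nia.
    * by lia.
    * by nia.
    * by move=> p ma mb lp H h; rewrite -H.
    * by move=> p p' a lp lp' ne -> []; lia.
    * by move=> p lp; exact: runs_output.
  + by [].
  + by [].
  move=> fr10 m10 [_ q10] _; apply: runs_skip => i lin.
  have iN : (i < N)%N by lia.
  have z0 : z != 0.
    apply/eqP => z0; have := @root_unity_exp_eq1 R n ltac:(lia).
    rewrite z0 expr0n (_ : (n == 0)%N = false); last by lia.
    by move/eqP; rewrite eq_sym oner_eq0.
  have N0 : N%:R != 0 :> R[i] by rewrite pnatr_eq0 expn_eq0.
  rewrite q10 // q9 // -(@bluestein _ z w n N i m z0 N0 p1 lin); last by lia.
  congr (_ * _ / _); apply: eq_big_nat => p /andP[_ lp]; congr (_ * _).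
  rewrite q8 //; congr (_ * _).
    rewrite u7; last by lia.
    rewrite q6 //; apply: eq_big_nat => j /andP[_ lj]; congr (_ * _).
    by have [] := q5 j lj.
  have mp : ((N - p) %% N < N)%N by rewrite ltn_mod; lia.
  have -> : (4 * N = 2 * (2 * N))%N by lia.
  rewrite q7 //; apply: eq_big_nat => j /andP[_ lj]; congr (_ * _).
  rewrite u6; last by lia.
  have -> : (2 * (2 * N) = 4 * N)%N by lia.
  by have [] := q5 j lj.
- have nl : (n * (45 * l + 60 + 15) <= N * (45 * l + 60 + 15))%N.
    by rewrite leq_mul2r; apply/orP; right; lia.
  have E1 : (N * (45 * l + 60 + 15) = 45 * (N * l) + 75 * N)%N by ring.
  have E2 : (N * (3 * fft_work c k + 300 * l + 300) =
      3 * (N * fft_work c k) + 300 * (N * l) + 300 * N)%N by ring.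
  by rewrite E2; rewrite E1 in nl *; lia.
- lia.
Qed.

End Main.

(** * The cost as a function of eps *)

Section Bounds.
Context (R : realType).
Implicit Types x y : R.

Lemma ln2_gt0 : 0 < ln 2 :> R.
Proof. by apply: ln_gt0; rewrite ltr1n. Qed.

Lemma le_lg x y : 0 < x -> x <= y -> lg x <= lg y.
Proof.
move=> x0 xy; rewrite /lg ler_pM2r ?invr_gt0 ?ln2_gt0 //.
by rewrite ler_ln // posrE //; exact: lt_le_trans xy.
Qed.

Lemma lgM x y : 0 < x -> 0 < y -> lg (x * y) = lg x + lg y.
Proof. by move=> x0 y0; rewrite /lg lnM ?posrE // mulrDl. Qed.

Lemma lg_exp2 (k : nat) : lg (2 ^ k)%:R = k%:R :> R.
Proof.
rewrite natrX /lg lnXn // -[ln 2 *+ k]mulr_natl mulfK //.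
by rewrite gt_eqF // ln2_gt0.
Qed.

Lemma lg2 : lg 2 = 1 :> R.
Proof. exact: (lg_exp2 1). Qed.

Lemma le_lg_nat (k n : nat) : (2 ^ k <= n)%N -> k%:R <= lg n%:R :> R.
Proof.
move=> le; rewrite -lg_exp2; apply: le_lg; last by rewrite ler_nat.
by rewrite ltr0n expn_gt0.
Qed.

Lemma lg_nat_le (k n : nat) :
  (0 < n)%N -> (n <= 2 ^ k)%N -> lg n%:R <= k%:R :> R.
Proof. by move=> n0 le; rewrite -[X in _ <= X]lg_exp2; apply: le_lg;
  rewrite ?ltr0n ?ler_nat. Qed.

Lemma ge4_of_lg (n : nat) : 2 <= lg n%:R :> R -> (4 <= n)%N.
Proof.
(* For n = 0 the logarithm takes the default value 0. *)
case: n => [|n]; first by rewrite /lg ln0 // mul0r => h; exfalso; lra.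
rewrite leqNgt => h; apply/negP => lt.
have : lg n.+1%:R <= lg 3 :> R by apply: le_lg; rewrite ?ltr0n // ler_nat.
have : lg 3 < 2 :> R.
  rewrite -[X in _ < X](lg_exp2 2) /lg ltr_pM2r ?invr_gt0 ?ln2_gt0 //.
  by rewrite ltr_ln ?posrE // ltr_nat.
lra.
Qed.

(** The factor 1 / lg (lg n) in the exponent changes the base from lg n to 2, leaving 2 ^ (lg n / T
    + lg T). It is a genuine inverse because lg n >= 2 gives lg (lg n) >= 1. *)
Lemma lg_powR_work_exponent (n : nat) (eps : R) :
  2 <= lg n%:R :> R ->
  let T := eps^-1 * lg eps^-1 in 0 < T ->
  lg n%:R `^ work_exponent n eps = T * expR (ln 2 * (lg n%:R / T)).
Proof.
move=> L2 T T0; set L := lg n%:R in L2 *.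
have ln2 := ln2_gt0.
have lnL : ln L = lg L * ln 2 by rewrite /lg divfK // gt_eqF.
have lgL : 1 <= lg L by rewrite -lg2; apply: le_lg.
rewrite /powR gt_eqF; last by lra.
rewrite /work_exponent -/L -/T lnL.
have -> : (lg L)^-1 * (L / T + lg T) * (lg L * ln 2) = ln 2 * (L / T) + ln T.
  rewrite {2}/lg; field; rewrite !gt_eqF //; lra.
by rewrite expRD lnK ?posrE // mulrC.
Qed.

Lemma sqr_le_exp2 (t : nat) : (t.+1 ^ 2 <= 4 * 2 ^ t)%N.
Proof.
(* The induction starts at t = 2, since (t + 2) ^ 2 <= 2 * (t + 1) ^ 2 fails for t = 0 and t = 1. *)
suff H u : (u.+3 ^ 2 <= 4 * 2 ^ u.+2)%N by case: t => [//|[//|t]]; exact: H.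
by elim: u => [//|u IH]; rewrite expnS; rewrite !expnS expn0 in IH *; nia.
Qed.

(* [2 ^ k] is of the order of [T = q * lg q], so that [k] halvings take [lg n]
   down to [lg n / T]. *)
Lemma tuning_bounds (n : nat) (q : R) :
  2 <= q <= lg n%:R ->
  let Q := `|Num.ceil q|%N in
  let l := (trunc_log 2 n + 2)%N in
  let k := (trunc_log 2 (Q * trunc_log 2 Q) + 2)%N in
  let T := q * lg q in
  [/\ (2 <= Q <= n)%N, (2 * n <= 2 ^ l <= 4 * n)%N,
    l%:R <= lg n%:R + 2 :> R /\ lg n%:R ^+ 2 <= 4 * n%:R :> R,
    T <= (2 ^ k)%:R <= 16 * T &
    k%:R <= 6 * lg q /\ 1 <= lg q <= lg n%:R].
Proof.
set L : R := lg n%:R => /andP[q2 qL] Q l k T.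
have L2 : 2 <= L by lra.
have n4 : (4 <= n)%N := ge4_of_lg L2.
have QR : Q%:R = (Num.ceil q)%:~R :> R.
  by rewrite natr_absz ger0_norm // ceil_ge0; lra.
have qQ : q <= Q%:R by rewrite QR; exact: ceil_ge.
have Qq : Q%:R < q + 1 by have := ceilB1_lt q; rewrite intrD -QR; lra.
clearbody Q.
have Q2 : (2 <= Q)%N by rewrite -(ler_nat R); lra.
pose t := trunc_log 2 n.
have /andP[t1 t2] : (2 ^ t <= n < 2 ^ t.+1)%N by apply: trunc_log_bounds => //;
  lia.
have tL : t%:R <= L := le_lg_nat t1.
have Lt : L <= t.+1%:R by apply: lg_nat_le; [exact: leq_trans n4|exact: ltnW].
have tn : (t.+1 <= n)%N by exact: leq_trans (ltn_expl _ (isT : (1 < 2)%N)) t1.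
have Ln : L <= n%:R by apply: le_trans Lt _; rewrite ler_nat.
have Qn : (Q <= n)%N by rewrite -ltnS -(ltr_nat R) -[n.+1%:R]natr1; lra.
have lE : (2 ^ l = 4 * 2 ^ t)%N by rewrite /l expnD mulnC.
have lgq1 : 1 <= lg q by rewrite -lg2; apply: le_lg; lra.
have lgqL : lg q <= L by apply: le_lg; lra.
have lgQ : lg Q%:R <= 2 * lg q.
  have : lg Q%:R <= lg (2 * q) by apply: le_lg; lra.
  by rewrite lgM ?lg2; lra.
have lgqQ : lg q <= lg Q%:R by apply: le_lg; lra.
pose v := trunc_log 2 Q.
have /andP[v1 v2] : (2 ^ v <= Q < 2 ^ v.+1)%N by apply: trunc_log_bounds => //;
  exact: ltnW.
have v0 : (0 < v)%N by rewrite trunc_log_gt0.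
have vQ : (v <= Q)%N by apply: ltnW;
  exact: leq_trans (ltn_expl _ (isT : (1 < 2)%N)) v1.
have vlg : v%:R <= lg Q%:R :> R := le_lg_nat v1.
have lgv : lg Q%:R <= v.+1%:R :> R by apply: lg_nat_le;
  [exact: ltnW|exact: ltnW].
have v1R : 1 <= v%:R :> R by rewrite (ler_nat R 1).
rewrite -natr1 in lgv.
pose u := trunc_log 2 (Q * v).
have /andP[u1 u2] : (2 ^ u <= Q * v < 2 ^ u.+1)%N.
  by apply: trunc_log_bounds => //; rewrite muln_gt0 v0 ltnW.
have kE : (2 ^ k = 4 * 2 ^ u)%N by rewrite /k expnD mulnC.
rewrite expnS in u2.
(* The summand 2 in k provides this factor 2, which is needed because the truncated logarithm v may
   be only about half of lg Q: from v >= 1 one gets lg Q <= v + 1 <= 2 v. *)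
have k1 : (2 * (Q * v) <= 2 ^ k)%N by rewrite kE; move: u2; clear; lia.
have k2 : (2 ^ k <= 4 * (Q * v))%N by rewrite kE leq_mul2l u1.
rewrite -(ler_nat R) !natrM in k1; rewrite -(ler_nat R) !natrM in k2.
split.
- by rewrite Q2.
- by rewrite lE; rewrite expnS in t2; move: t1 t2; clear; lia.
- split; first by rewrite /l natrD; lra.
  have : (t.+1 ^ 2 <= 4 * n)%N by apply: leq_trans (sqr_le_exp2 t) _;
    rewrite leq_mul2l t1.
  rewrite -(ler_nat R) natrX natrM => h; apply: le_trans h.
  by rewrite ler_pXn2r // nnegrE; lra.
- rewrite /T; apply/andP; split.
    apply: le_trans k1.
    have : q * lg q <= Q%:R * (2 * v%:R) by apply: ler_pM; lra.
    lra.
  apply: (le_trans k2).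
  have : Q%:R * v%:R <= (2 * q) * (2 * lg q) by apply: ler_pM; lra.
  lra.
- split; last by apply/andP.
  have : u%:R <= lg (Q * v)%:R :> R by apply: le_lg_nat.
  have : lg (Q * v)%:R <= lg (Q%:R * Q%:R) :> R by apply: le_lg;
    rewrite -?natrM ?ltr0n ?ler_nat ?leq_mul2l ?vQ ?orbT // muln_gt0 v0 ltnW.
  rewrite lgM ?ltr0n ?(ltnW Q2) //.
  by rewrite /k natrD -/v -/u; lra.
Qed.

(** The excess of l over lg n is at most 2 and T >= 2, so division by T reduces it to at most 1.
    With the successor that makes up for rounding the quotient down, the exponent exceeds L / T by
    at most 2, whence the factor 4. *)
Lemma exp2_quotient_le (l k : nat) (L T : R) :
  2 <= T -> T <= (2 ^ k)%:R -> l%:R <= L + 2 -> 0 <= L ->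
  (2 ^ (l %/ 2 ^ k).+1)%:R <= 4 * expR (ln 2 * (L / T)).
Proof.
move=> T2 Tk lL L0.
have k0 : 0 < (2 ^ k)%:R :> R by rewrite ltr0n expn_gt0.
have quo : (l %/ 2 ^ k)%:R <= L / T + 1.
  have h1 : (l %/ 2 ^ k)%:R * (2 ^ k)%:R <= l%:R :> R.
    by rewrite -natrM ler_nat leq_divM.
  have h2 : (l %/ 2 ^ k)%:R * T <= (l %/ 2 ^ k)%:R * (2 ^ k)%:R.
    by rewrite ler_wpM2l.
  have -> : L / T + 1 = (L + T) / T by field; lra.
  by rewrite ler_pdivlMr; lra.
have -> : (2 ^ (l %/ 2 ^ k).+1)%:R = expR (ln 2 * (l %/ 2 ^ k).+1%:R) :> R.
  by rewrite expRM_natr lnK ?natrX // posrE ltr0n.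
have -> : 4 = expR (ln 2 * 2) :> R.
  by rewrite expRM_natr lnK ?posrE ?ltr0n // -natrX.
rewrite -expRD ler_expR -mulrDr ler_wpM2l //; first exact/ltW/ln2_gt0.
by rewrite -natr1; lra.
Qed.

End Bounds.

(** * Collecting the constants, and the theorem *)

Lemma total_work_le (l k c : nat) :
  (l <= c * 2 ^ k)%N ->
  (2 ^ l * (3 * fft_work c k + 300 * l + 300) <=
   12 * 180 * (2 ^ l * (2 ^ k * 2 ^ c)))%N.
Proof.
move=> lc; rewrite mulnCA leq_mul2l; apply/orP; right.
have cl : (c < 2 ^ c)%N by exact: ltn_expl.
have k0 : (0 < 2 ^ k)%N by rewrite expn_gt0.
(* This absorbs the O(l) work per cell outside the transforms; 12 * 180 is 3 * (120 + 400) + 300 +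
   300. *)
have l2 : (l <= 2 ^ k * 2 ^ c)%N.
  by apply: leq_trans lc _; rewrite mulnC leq_mul2l (ltnW cl) orbT.
have h0 : (2 ^ k <= 2 ^ k * 2 ^ c)%N by rewrite leq_pmulr // expn_gt0.
by rewrite /fft_work mulnDr mulnCA; lia.
Qed.

Lemma total_span_le (l k : nat) :
  (3 * fft_span l k + 400 * l + 400 <=
   300 * (l * k.+1) + 24 * 100 * 2 ^ k + 400 * l + 400)%N.
Proof. by rewrite /fft_span expnS -!mulnA; lia. Qed.

Lemma initial_frameE (R : realType) (n q : nat) :
  initial_frame R n q = call_frame [:: n; q] [::].
Proof. by rewrite /initial_frame /call_frame; congr Frame;
  apply/funext => -[]. Qed.

Theorem theorem9 (R : realType) :
  exists (P : program) (c : nat) (K : R),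
    forall (n : nat) (eps : R),
      2 <= eps^-1 <= lg n%:R ->
      computes_dft P (n ^ c)%N n `|Num.ceil eps^-1|%N
        (K * (n%:R * lg n%:R `^ work_exponent n eps))
        (K * n%:R)
        (K * (lg eps^-1 * lg n%:R)).
Proof.
(* The last constant dominates 12 * 180 * 256 for the work, 50 * 1000 for the span, and 24 + 4 * 50
   * 1000 + 1 for the space. *)
exists fft_program, 5%N, (100 * 100 * 100) => n eps qL.
have := tuning_bounds qL.
set q := eps^-1 in qL *; set L : R := lg n%:R; set Q := `|_|%N.
pose l := (trunc_log 2 n + 2)%N.
pose k := (trunc_log 2 (Q * trunc_log 2 Q) + 2)%N.
rewrite -/l -/k => -[Qn /andP[N1 N2] [lL Ln] /andP[k1 k2] [kq /andP[lq1 lqL]]].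
have [q2 {}qL] : 2 <= q /\ q <= L by apply/andP.
have n4 : (4 <= n)%N by apply: (@ge4_of_lg R); exact: le_trans qL.
have lE : l = (trunc_log 2 n + 2)%N by [].
have kE : (trunc_log 2 (Q * trunc_log 2 Q) + 2)%N = k by [].
rewrite kE in k1 k2 kq; clearbody l k.
set T := q * lg q in k1 k2.
have L0 : 0 <= L by apply: le_trans qL; exact: le_trans q2.
have T2 : 2 <= T.
  by have : 2 * 1 <= q * lg q by [apply: ler_pM; lra]; rewrite mulr1.
pose c := (l %/ 2 ^ k).+1.
have lc : (l <= c * 2 ^ k)%N by apply: ltnW; rewrite ltn_ceil ?expn_gt0.
(* By 2 ^ l <= 4 n the left side is at most 32 n ^ 2, and n ^ 3 >= 64 since n >= 4. *)
have W : (2 * 2 ^ l * 2 ^ l < n ^ 5)%N.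
  have n3 : (4 ^ 3 <= n ^ 3)%N by rewrite leq_exp2r.
  have -> : (n ^ 5 = n ^ 2 * n ^ 3)%N by rewrite -expnD.
  by move: n3 N2; rewrite !expnS expn0; clear; nia.
pose N := (2 ^ l)%N.
have workR : (N * (3 * fft_work c k + 300 * l + 300))%:R <=
    100 * 100 * 100 * (n%:R * lg n%:R `^ work_exponent n eps).
  rewrite lg_powR_work_exponent; [|exact: le_trans qL|exact: lt_le_trans T2].
  rewrite -/q -/T -/L.
  have h : (N * (3 * fft_work c k + 300 * l + 300))%:R <=
      12 * 180 * ((2 ^ l)%:R * ((2 ^ k)%:R * (2 ^ c)%:R)) :> R.
    by rewrite -!natrM ler_nat; exact: total_work_le.
  apply: (le_trans h).
  have cE : (2 ^ c)%:R <= 4 * expR (ln 2 * (L / T)).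
    by apply: exp2_quotient_le => //; lra.
  set E := expR _ in cE *.
  have N2' : (2 ^ l)%:R <= 4 * n%:R :> R by rewrite -natrM ler_nat.
  have h1 : (2 ^ k)%:R * (2 ^ c)%:R <= (16 * T) * (4 * E) by exact: ler_pM.
  have h2 : (2 ^ l)%:R * ((2 ^ k)%:R * (2 ^ c)%:R) <=
      (4 * n%:R) * ((16 * T) * (4 * E)) by apply: ler_pM => //; exact: mulr_ge0.
  have TE : 0 <= n%:R * (T * E).
    apply: mulr_ge0; first exact: ler0n.
    by apply: mulr_ge0; [exact: le_trans T2|exact: expR_ge0].
  have E1 : (4 * n%:R) * ((16 * T) * (4 * E)) = 256 * (n%:R * (T * E)) by ring.
  rewrite E1 in h2; lra.
have spanR : (3 * fft_span l k + 400 * l + 400)%:R <= 50 * 1000 * (lg q * L).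
  have k0 : (0 < 2 ^ k.+1)%N by rewrite expn_gt0.
  have h : (3 * fft_span l k + 400 * l + 400)%:R <=
      300 * (l%:R * k.+1%:R) + 24 * 100 * (2 ^ k)%:R + 400 * l%:R + 400 :> R.
    by rewrite -!natrM -!natrD ler_nat; exact: total_span_le.
  apply: (le_trans h); rewrite -[k.+1%:R]natr1.
  have h1 : l%:R * (k%:R + 1) <= (2 * L) * (7 * lg q) by apply: ler_pM => //;
    lra.
  have h2 : T <= L * lg q by apply: ler_wpM2r => //; exact: le_trans lq1.
  have h3 : L * 1 <= L * lg q by exact: ler_wpM2l.
  by rewrite [lg q * L]mulrC; lra.
exists (6 * N)%N => a m ma.
have := @runs_main R _ n l W n4 N1 lE m Q c.
rewrite /= kE => /(_ Qn lc) [fr' [m' [t [H _ _ [cw cs] q']]]].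
exists fr', m', t; split.
- by rewrite initial_frameE.
- move=> i; rewrite q' // big_mkord /dft.
  by apply: eq_bigr => j _; rewrite ma.
- by apply: le_trans workR; rewrite ler_nat.
- have := exec_depth_le_span H => dep.
  have h : (6 * N + (trace_depth t).+1)%:R <=
      24 * n%:R + (3 * fft_span l k + 400 * l + 400)%:R + 1 :> R.
    rewrite -natrM -!natrD natr1 ler_nat /N.
    move: (3 * _ + _ + _)%N dep cs N2 => B; clear; lia.
  apply: (le_trans h).
  (* The frames number at most span + 1, and lg q <= L together with L ^ 2 <= 4 n makes this linear
     in n. *)
  have h1 : lg q * L <= L ^+ 2 by rewrite expr2; exact: ler_wpM2r.
  have h2 : 1 <= n%:R :> R by rewrite (ler_nat R 1); exact: leq_trans n4.
  by lra.
- have h0 : 0 <= lg q * L by apply: mulr_ge0; lra.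
  apply: (@le_trans _ _ (3 * fft_span l k + 400 * l + 400)%:R).
    by rewrite ler_nat.
  by apply: (le_trans spanR); lra.
Qed.
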